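(* Let $M=M_1\times_fM_2$ be a Lyra twisted warped product with $g=g_1\oplus f^2g_2$, scale $\varphi$, $k=\ln f$, $\sigma=\ln\varphi$, $g_L=e^{2\sigma}g$, $n=n_1+n_2$. Let $u,\lambda\in C^\infty(M)$, $\rho\in\mathbb R$, $\Lambda=\lambda+\rho R^L$ and $\Psi_{u,\sigma}=\langle\nabla u,\nabla\sigma\rangle_g-\Delta\sigma-(n-2)|\nabla\sigma|_g^2$. Then $u$ determines a gradient Lyra almost Ricci--Bourguignon soliton, i.e. $\operatorname{Ric}^L+\operatorname{Hess}^Lu=(\lambda+\rho R^L)g_L$, if and only if the following hold. For all horizontal lifts $X,Y$: $$\operatorname{Ric}_1(X,Y)-n_2[\operatorname{Hess}_1k(X,Y)+X(k)Y(k)]+\operatorname{Hess}_1u(X,Y)-(n-2)\operatorname{Hess}_1\sigma(X,Y)+(n-2)X(\sigma)Y(\sigma)-X(u)Y(\sigma)-X(\sigma)Y(u)=[e^{2\sigma}\Lambda-\Psi_{u,\sigma}]\,g_1(X,Y).$$ For all vertical lifts $U,V$: $$\operatorname{Ric}(U,V)+\operatorname{Hess}u(U,V)-(n-2)\operatorname{Hess}\sigma(U,V)+(n-2)U(\sigma)V(\sigma)-U(u)V(\sigma)-U(\sigma)V(u)=f^2[e^{2\sigma}\Lambda-\Psi_{u,\sigma}]\,g_2(U,V).$$ For all horizontal lifts $X$ and vertical lifts $U$: $$0=-(n_2-1)XU(k)+XU(u)-X(k)U(u)-(n-2)[XU(\sigma)-X(k)U(\sigma)]+(n-2)X(\sig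ma)U(\sigma)-X(u)U(\sigma)-X(\sigma)U(u).$$
   Context: Lyra twisted warped product: $(M_1,g_1),(M_2,g_2)$ are smooth pseudo-Riemannian manifolds of positive dimensions $n_1,n_2$; $f,\varphi:M_1\times M_2\to(0,\infty)$ are smooth; $M=M_1\times M_2$ carries $g=g_1\oplus f^2g_2$ and $g_L=\varphi^2g$. Horizontal (vertical) lifts are the canonical lifts to $M$ of vector fields on $M_1$ (on $M_2$); $XU(h)=X(U(h))$. $\operatorname{Ric}^L,R^L,\operatorname{Hess}^L$ are the Ricci tensor, scalar curvature and Hessian of $g_L$; $\operatorname{Ric},\nabla,\operatorname{Hess},\Delta$ (trace of Hessian), $\langle\cdot,\cdot\rangle_g$, $|v|_g^2=g(v,v)$ are those of $g$. $\operatorname{Ric}_1$ is the Ricci tensor of $g_1$, and $\operatorname{Hess}_1h$ is the Hessian of $h$ on $(M_1,g_1)$ with the $M_2$-variable held fixed. Sign convention: round spheres have positive Ricci curvature. *)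

(* Defs.v *)
From HB Require Import structures.
From mathcomp Require Import all_boot all_order all_algebra.
From mathcomp Require Import all_classical all_reals all_analysis.

Set Implicit Arguments.
Unset Strict Implicit.
Unset Printing Implicit Defensive.

Import Order.TTheory GRing.Theory Num.Theory.
Import numFieldNormedType.Exports.

Local Open Scope classical_set_scope.
Local Open Scope ring_scope.

Section Smooth.
Context {R : realType}.
Implicit Types V W : normedModType R.

(* Only meaningful for [A] open.  In finite dimension this is the usual C^k:
   the differential is C^(k-1) iff all directional derivatives are. *)
Fixpoint Ck {V W : normedModType R} (k : nat) (A : set V) (h : V -> W) : Prop :=
  if k is k'.+1 then
    (forall x, A x -> differentiable h x) /\
    (forall v : V, Ck k' A (fun x => 'D_v h x))
  else forall x, A x -> {for x, continuous h}.

Definition smooth_on {V W : normedModType R} (A : set V) (h : V -> W) :=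
  forall k, Ck k A h.

Lemma near_eq_differentiable V W (h h' : V -> W) x :
  (\near x, h x = h' x) -> differentiable h x -> differentiable h' x.
Proof.
move=> E dh; have -> : h' = h + (h' - h) by apply/funext => y; rewrite /= !fctE addrC subrK.
apply: differentiableD => //.
have kx : (h' - h) x = 0 by rewrite !fctE (nbhs_singleton E) subrr.
have ko : (h' - h) \o shift x = cst ((h' - h) x) + (\0 : V -> W) +o_ 0 id.
  apply/eqaddoP => _/posnumP[e]; rewrite near_simpl.
  have : \forall y \near (0 : V), h (y + x) = h' (y + x).
    by move: E; rewrite (near_shift 0 x)/= subr0.
  apply: filterS => y Ey; rewrite kx !fctE /= Ey subrr addr0 subrr normr0.
  by rewrite mulr_ge0.
have c0 : continuous (\0 : V -> W) by move=> ?; exact: cvg_cst.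
by apply/diff_locallyP; rewrite (diff_unique c0 ko).
Qed.

Lemma Ck_ext V W k (A : set V) (h h' : V -> W) :
  open A -> (forall x, A x -> h x = h' x) -> Ck k A h -> Ck k A h'.
Proof.
move=> oA; elim: k h h' => [|k IH] h h' E /=; have nE x : A x -> \near x, h x = h' x
  by move=> Ax; near=> y; apply: E; near: y; exact: open_nbhs_nbhs.
  move=> H x Ax; move: (H x Ax); rewrite /prop_for /continuous_at -(E x)// => ch.
  by apply: cvg_trans ch; apply: near_eq_cvg; exact: nE.
case=> dh Dh; split=> [x Ax|v].
  exact: near_eq_differentiable (nE _ Ax) (dh _ Ax).
by apply: IH (Dh v) => x Ax; apply: near_eq_derive; exact: nE.
Unshelve. all: by end_near. Qed.

Lemma Ck_sub V W k (A B : set V) (h : V -> W) :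
  A `<=` B -> Ck k B h -> Ck k A h.
Proof.
move=> AB; elim: k h => [|k IH] h /= => [ch x /AB|[dh Dh]]; first exact: ch.
by split=> [x /AB|v]; [exact: dh|exact: IH].
Qed.

Lemma CkD V W k (A : set V) (h h' : V -> W) :
  open A -> Ck k A h -> Ck k A h' -> Ck k A (h + h').
Proof.
move=> oA; elim: k h h' => [|k IH] h h' /=.
  by move=> ch ch' x Ax; apply: cvgD; [exact: ch|exact: ch'].
move=> [dh Dh] [dh' Dh']; split=> [x Ax|v].
  by apply: differentiableD; [exact: dh|exact: dh'].
apply: Ck_ext (IH _ _ (Dh v) (Dh' v)) => // x Ax; rewrite !fctE deriveD//.
  exact/diff_derivable/dh.
exact/diff_derivable/dh'.
Qed.

Lemma Ck_linear_comp (V V' W W' : normedModType R) k (A : set V) (h : V -> W)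
    (P : {linear V' -> V}) (L : {linear W -> W'}) :
  continuous P -> continuous L -> open A ->
  Ck k A h -> Ck k (P @^-1` A) (L \o h \o P).
Proof.
move=> cP cL oA; have oPA : open (P @^-1` A) by apply: open_comp => // ? _; exact: cP.
elim: k h => [|k IH] h /=.
  move=> ch x Ax; apply: continuous_comp; first exact: cP.
  by apply: continuous_comp; [exact: ch|exact: cL].
move=> [dh Dh]; split=> [x Ax|v].
  apply: differentiable_comp; first exact: linear_differentiable.
  by apply: differentiable_comp; [exact: dh|exact: linear_differentiable].
apply: Ck_ext (IH _ (Dh (P v))) => // x Ax /=.
have dhx := dh _ Ax.
have dL y : differentiable L y by exact: linear_differentiable.
have dP y : differentiable P y by exact: linear_differentiable.
have dLh : differentiable (L \o h) (P x) by exact: differentiable_comp.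
have dLhP : differentiable (L \o h \o P) x by exact: differentiable_comp.
by rewrite !deriveE// (diff_comp (dP x) dLh) /= (diff_comp dhx (dL _)) /= !diff_lin.
Qed.
End Smooth.

(* A chart is a homeomorphism between the open sets [chart_dom] and
   [chart_cod]; both maps are totalized and irrelevant outside these sets. *)
Record chart (R : realType) (T : topologicalType) (n : nat) := Chart {
  chart_dom : set T;
  chart_cod : set 'rV[R]_n;
  chart_map : T -> 'rV[R]_n;
  chart_inv : 'rV[R]_n -> T
}.

Record is_chart {R : realType} {T : topologicalType} {n : nat}
    (c : chart R T n) : Prop := IsChart {
  chart_dom_open : open (chart_dom c);
  chart_cod_open : open (chart_cod c);
  chart_map_in : forall p, chart_dom c p -> chart_cod c (chart_map c p);
  chart_inv_in : forall x, chart_cod c x -> chart_dom c (chart_inv c x);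
  chart_mapK : forall p, chart_dom c p -> chart_inv c (chart_map c p) = p;
  chart_invK : forall x, chart_cod c x -> chart_map c (chart_inv c x) = x;
  chart_map_continuous :
    forall p, chart_dom c p -> {for p, continuous (chart_map c)};
  chart_inv_continuous :
    forall x, chart_cod c x -> {for x, continuous (chart_inv c)}
}.

Definition transition_dom {R : realType} {T : topologicalType} {n : nat}
    (c c' : chart R T n) : set 'rV[R]_n :=
  chart_cod c `&` chart_inv c @^-1` chart_dom c'.

Definition transition {R : realType} {T : topologicalType} {n : nat}
    (c c' : chart R T n) : 'rV[R]_n -> 'rV[R]_n :=
  chart_map c' \o chart_inv c.

Record manifold (R : realType) (n : nat) := Manifold {
  carrier :> topologicalType;
  idx : Type;
  charts : idx -> chart R carrier n;
  charts_is_chart : forall i, is_chart (charts i);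
  charts_cover : forall p : carrier, exists i, chart_dom (charts i) p;
  charts_smooth : forall i j,
    smooth_on (transition_dom (charts i) (charts j))
              (transition (charts i) (charts j));
  manifold_hausdorff : hausdorff_space carrier;
  manifold_second_countable : @second_countable carrier
}.
Arguments idx {R n} M : rename.
Arguments charts {R n} M i : rename.

Section ProductManifold.
Context {R : realType} {n1 n2 : nat}.

Definition prod_chart (T1 T2 : topologicalType)
    (c1 : chart R T1 n1) (c2 : chart R T2 n2)
  : chart R (T1 * T2)%type (n1 + n2) :=
  @Chart R (T1 * T2)%type (n1 + n2)
    (chart_dom c1 `*` chart_dom c2)
    [set x | chart_cod c1 (lsubmx x) /\ chart_cod c2 (rsubmx x)]
    (fun p => row_mx (chart_map c1 p.1) (chart_map c2 p.2))
    (fun x => (chart_inv c1 (lsubmx x), chart_inv c2 (rsubmx x))).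

Lemma cvg_row_mx (T : Type) (F : set_system T) (FF : Filter F)
    (u : T -> 'rV[R]_n1) (v : T -> 'rV[R]_n2)
    (a : 'rV[R]_n1) (b : 'rV[R]_n2) :
  u @ F --> a -> v @ F --> b -> (fun t => row_mx (u t) (v t)) @ F --> row_mx a b.
Proof.
move=> ua vb; apply/cvg_ballP => e e0.
move/cvg_ballP : ua => /(_ e e0) ua; move/cvg_ballP : vb => /(_ e e0) vb.
near=> t; split => // i j.
have [_ ut] : ball a e (u t) by near: t.
have [_ vt] : ball b e (v t) by near: t.
by case: (splitP j) => k jk; rewrite !mxE; case: splitP => l jl.
Unshelve. all: by end_near. Qed.

Lemma prod_chartP (T1 T2 : topologicalType)
    (c1 : chart R T1 n1) (c2 : chart R T2 n2) :
  is_chart c1 -> is_chart c2 -> is_chart (prod_chart c1 c2).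
Proof.
move=> h1 h2; split=> /=.
- rewrite openE => -[p q] [/= dp dq].
  exists (chart_dom c1, chart_dom c2) => //; split; apply: open_nbhs_nbhs;
  by split => //; exact: chart_dom_open.
- rewrite [X in open X](_ : _ = (lsubmx @^-1` chart_cod c1) `&`
    (rsubmx @^-1` chart_cod c2))//; apply: openI.
    apply: open_comp; last exact: chart_cod_open.
    by move=> x _; exact: continuous_lsubmx.
  apply: open_comp; last exact: chart_cod_open.
  by move=> x _; exact: continuous_rsubmx.
- by move=> p [dp1 dp2]; rewrite row_mxKl row_mxKr; split; exact: chart_map_in.
- by move=> x [x1 x2]; split; exact: chart_inv_in.
- by move=> [p q] [/= dp dq]; rewrite row_mxKl row_mxKr !chart_mapK.
- by move=> x [x1 x2]; rewrite !chart_invK// hsubmxK.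
- move=> [p q] [/= dp dq]; apply: cvg_row_mx.
    by apply: (@continuous_comp _ _ _ fst (chart_map c1));
      [exact: cvg_fst|exact: chart_map_continuous].
  by apply: (@continuous_comp _ _ _ snd (chart_map c2));
    [exact: cvg_snd|exact: chart_map_continuous].
- move=> x [x1 x2].
  have v1 : {for x, continuous (chart_inv c1 \o lsubmx)}.
    by apply: continuous_comp;
      [exact: continuous_lsubmx|exact: chart_inv_continuous].
  have v2 : {for x, continuous (chart_inv c2 \o rsubmx)}.
    by apply: continuous_comp;
      [exact: continuous_rsubmx|exact: chart_inv_continuous].
  exact: cvg_pair v1 v2.
Qed.

Lemma transition_dom_open (T : topologicalType) n (c c' : chart R T n) :
  is_chart c -> is_chart c' -> open (transition_dom c c').
Proof.
move=> h h'; rewrite openE => x [cx dx]; apply: filterI.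
  by apply: open_nbhs_nbhs; split => //; exact: chart_cod_open.
apply: chart_inv_continuous => //.
by apply: open_nbhs_nbhs; split => //; exact: chart_dom_open.
Qed.

Lemma prod_charts_smooth (T1 T2 : topologicalType)
    (c1 c1' : chart R T1 n1) (c2 c2' : chart R T2 n2) :
  is_chart c1 -> is_chart c1' -> is_chart c2 -> is_chart c2' ->
  smooth_on (transition_dom c1 c1') (transition c1 c1') ->
  smooth_on (transition_dom c2 c2') (transition c2 c2') ->
  smooth_on (transition_dom (prod_chart c1 c2) (prod_chart c1' c2'))
            (transition (prod_chart c1 c2) (prod_chart c1' c2')).
Proof.
move=> h1 h1' h2 h2' s1 s2 k.
pose L1 : {linear 'rV[R]_n1 -> 'rV[R]_(n1 + n2)} := mulmxr (row_mx 1%:M 0).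
pose L2 : {linear 'rV[R]_n2 -> 'rV[R]_(n1 + n2)} := mulmxr (row_mx 0 1%:M).
have L1E v : L1 v = row_mx v 0 by rewrite /L1/= mul_mx_row mulmx1 mulmx0.
have L2E v : L2 v = row_mx 0 v by rewrite /L2/= mul_mx_row mulmx1 mulmx0.
have cL1 : continuous L1.
  move=> v; rewrite /continuous_at L1E.
  rewrite (_ : (L1 : _ -> _) = fun v => row_mx v 0); last exact/funext.
  exact: (cvg_row_mx (nbhs_filter v) (u := id) (v := cst 0) cvg_id (cvg_cst _)).
have cL2 : continuous L2.
  move=> v; rewrite /continuous_at L2E.
  rewrite (_ : (L2 : _ -> _) = fun v => row_mx 0 v); last exact/funext.
  exact: (cvg_row_mx (nbhs_filter v) (u := cst 0) (v := id) (cvg_cst _) cvg_id).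
set D1 := transition_dom c1 c1'; set D2 := transition_dom c2 c2'.
have oD1 : open D1 by exact: transition_dom_open.
have oD2 : open D2 by exact: transition_dom_open.
have DE : transition_dom (prod_chart c1 c2) (prod_chart c1' c2') =
    (lsubmx @^-1` D1) `&` (rsubmx @^-1` D2).
  by apply/seteqP; split=> x [] [] ? ? [] ? ?; split; split.
have oP1 : open (lsubmx @^-1` D1 : set 'rV[R]_(n1 + n2)).
  by apply: open_comp => // x _; exact: continuous_lsubmx.
have oP2 : open (rsubmx @^-1` D2 : set 'rV[R]_(n1 + n2)).
  by apply: open_comp => // x _; exact: continuous_rsubmx.
rewrite DE.
have -> : transition (prod_chart c1 c2) (prod_chart c1' c2') =
    ((L1 \o transition c1 c1' \o lsubmx) + (L2 \o transition c2 c2' \o rsubmx))%R.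
  apply/funext => x; rewrite [RHS]/= !fctE L1E L2E add_row_mx addr0 add0r.
  by [].
apply: CkD; first exact: openI.
  apply: Ck_sub; last first.
    apply: (Ck_linear_comp _ _ oD1 (s1 k)) => //.
    exact: continuous_lsubmx.
  by move=> x [].
apply: Ck_sub; last first.
  apply: (Ck_linear_comp _ _ oD2 (s2 k)) => //.
  exact: continuous_rsubmx.
by move=> x [].
Qed.

Lemma hausdorff_prod (T1 T2 : topologicalType) :
  hausdorff_space T1 -> hausdorff_space T2 -> hausdorff_space (T1 * T2)%type.
Proof.
move=> h1 h2 [p1 p2] [q1 q2] pq; congr pair.
  apply: h1 => A B nA nB.
  have [] := pq (fst @^-1` A) (fst @^-1` B).
  - by apply: cvg_fst.
  - by apply: cvg_fst.
  by move=> [a b] [/= ? ?]; exists a.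
apply: h2 => A B nA nB.
have [] := pq (snd @^-1` A) (snd @^-1` B).
- by apply: cvg_snd.
- by apply: cvg_snd.
by move=> [a b] [/= ? ?]; exists b.
Qed.

Lemma second_countable_prod (T1 T2 : topologicalType) :
  @second_countable T1 -> @second_countable T2 ->
  @second_countable (T1 * T2)%type.
Proof.
move=> [B1 cB1 [oB1 nB1]] [B2 cB2 [oB2 nB2]].
exists [set U.1 `*` U.2 | U in B1 `*` B2].
  exact/(sub_countable (card_image_le _ _))/countableX.
split=> [_ [[U V] [/= /oB1 oU /oB2 oV] <-]|[p q] A [[/= U V] [/= nU nV] UV]].
  rewrite openE => -[x y] [/= Ux Vy].
  by exists (U, V) => //; split; apply: open_nbhs_nbhs.
have [U' [B1U' U'p] U'U] := nB1 p U nU.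
have [V' [B2V' V'q] V'V] := nB2 q V nV.
exists (U' `*` V'); first by split => //; exists (U', V').
by apply: subset_trans UV => -[x y] [/= ? ?]; split; [exact: U'U|exact: V'V].
Qed.

Definition prod_manifold (M1 : manifold R n1) (M2 : manifold R n2)
  : manifold R (n1 + n2) :=
  @Manifold R (n1 + n2) (M1 * M2)%type (idx M1 * idx M2)%type
    (fun c => prod_chart (charts M1 c.1) (charts M2 c.2))
    (fun c => prod_chartP (charts_is_chart c.1) (charts_is_chart c.2))
    (fun p => let: ex_intro i di := charts_cover p.1 in
              let: ex_intro j dj := charts_cover p.2 in
              ex_intro _ (i, j) (conj di dj))
    (fun c c' => prod_charts_smooth
       (charts_is_chart c.1) (charts_is_chart c'.1)
       (charts_is_chart c.2) (charts_is_chart c'.2)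
       (charts_smooth c.1 c'.1) (charts_smooth c.2 c'.2))
    (hausdorff_prod (@manifold_hausdorff R n1 M1) (@manifold_hausdorff R n2 M2))
    (second_countable_prod (@manifold_second_countable R n1 M1)
                           (@manifold_second_countable R n2 M2)).

End ProductManifold.

(* A field on [M] is given by its components in every chart of the atlas, as
   functions of the coordinates; the values outside the codomain of the chart
   are irrelevant. *)

Section Fields.
Context {R : realType} {n : nat}.
Implicit Types M : manifold R n.

Definition scalar_field M := idx M -> 'rV[R]_n -> R.
Definition vector_field M := idx M -> 'rV[R]_n -> 'rV[R]_n.
Definition tensor2 M := idx M -> 'rV[R]_n -> 'M[R]_n.

Definition loc {M} (h : M -> R) : scalar_field M :=
  fun i x => h (chart_inv (charts M i) x).

Definition smooth_fun {M} (h : M -> R) : Prop :=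
  forall i, smooth_on (chart_cod (charts M i)) (loc h i).

(* A smooth vector field: smooth components that change by the differential of
   the transition maps. *)
Definition smooth_vector_field {M} (X : vector_field M) : Prop :=
  (forall i, smooth_on (chart_cod (charts M i)) (X i)) /\
  (forall i j x, transition_dom (charts M i) (charts M j) x ->
     let t := transition (charts M i) (charts M j) in
     X j (t x) = 'D_(X i x) t x).

Definition vder {M} (X : vector_field M) (h : scalar_field M) : scalar_field M :=
  fun i x => 'D_(X i x) (h i) x.

Definition bilin (A : 'M[R]_n) (v w : 'rV[R]_n) : R := (v *m A *m w^T) 0 0.

Definition evalT {M} (T : tensor2 M) (X Y : vector_field M) : scalar_field M :=
  fun i x => bilin (T i x) (X i x) (Y i x).

(* [A] has exactly [q] negative squares in Sylvester normal form. *)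
Definition has_index (A : 'M[R]_n) (q : nat) : Prop :=
  exists2 P : 'M[R]_n, P \in unitmx &
    P *m A *m P^T = diag_mx (\row_(i < n) (-1) ^+ (i < q)%N).

Record pseudo_riemannian {M} (g : tensor2 M) : Prop := PseudoRiemannian {
  metric_smooth : forall i, smooth_on (chart_cod (charts M i)) (g i);
  metric_tensorial : forall i j x,
    transition_dom (charts M i) (charts M j) x ->
    let t := transition (charts M i) (charts M j) in
    forall v w, bilin (g i x) v w = bilin (g j (t x)) ('D_v t x) ('D_w t x);
  metric_sym : forall i x, chart_cod (charts M i) x -> (g i x)^T = g i x;
  metric_nondegenerate :
    forall i x, chart_cod (charts M i) x -> g i x \in unitmx;
  metric_index : exists q,
    forall i x, chart_cod (charts M i) x -> has_index (g i x) q
}.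

End Fields.

Section LocalGeometry.
Context {R : realType} {n : nat}.
Implicit Types (G : 'rV[R]_n -> 'M[R]_n) (h : 'rV[R]_n -> R).

Definition partial (i : 'I_n) h : 'rV[R]_n -> R :=
  fun x => 'D_(delta_mx 0 i) h x.

(* Gamma^k_ij *)
Definition christoffel G (k i j : 'I_n) : 'rV[R]_n -> R := fun x =>
  2^-1 * \sum_(l < n) invmx (G x) k l *
    (partial i (fun y => G y j l) x + partial j (fun y => G y i l) x
     - partial l (fun y => G y i j) x).

(* The component along d_l of the vector R(d_i, d_j) d_k, where
   R(X, Y) Z = D_X D_Y Z - D_Y D_X Z - D_[X, Y] Z. *)
Definition riemann G (l k i j : 'I_n) : 'rV[R]_n -> R := fun x =>
  partial i (christoffel G l j k) x - partial j (christoffel G l i k) x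
  + \sum_(m < n) (christoffel G l i m x * christoffel G m j k x
                  - christoffel G l j m x * christoffel G m i k x).

(* Ric(Y, Z) = trace (X |-> R(X, Y) Z); positive on round spheres. *)
Definition ricci G : 'rV[R]_n -> 'M[R]_n := fun x =>
  \matrix_(j < n, k < n) \sum_(i < n) riemann G i k i j x.

Definition hessian G h : 'rV[R]_n -> 'M[R]_n := fun x =>
  \matrix_(i < n, j < n) (partial i (partial j h) x
    - \sum_(k < n) christoffel G k i j x * partial k h x).

End LocalGeometry.

Section Geometry.
Context {R : realType} {n : nat} {M : manifold R n}.
Implicit Types (g : tensor2 M) (h : scalar_field M).

Definition Ric g : tensor2 M := fun i => ricci (g i).

Definition Hess g h : tensor2 M := fun i => hessian (g i) (h i).

Definition gtrace g (T : tensor2 M) : scalar_field M :=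
  fun i x => \tr (invmx (g i x) *m T i x).

Definition scalar_curvature g : scalar_field M := gtrace g (Ric g).

Definition laplacian g h : scalar_field M := gtrace g (Hess g h).

Definition gradient g h : vector_field M := fun i x =>
  (\row_(j < n) partial j (h i) x) *m invmx (g i x).

Definition gradient_almost_RB_soliton g (u lambda : M -> R) (rho : R) : Prop :=
  forall i x, chart_cod (charts M i) x ->
    Ric g i x + Hess g (loc u) i x
    = (loc lambda i x + rho * scalar_curvature g i x) *: g i x.

End Geometry.

Section Twisted.
Context {R : realType} {n1 n2 : nat}.
Context {M1 : manifold R n1} {M2 : manifold R n2}.
Local Notation M := (prod_manifold M1 M2).

Definition hlift (X : vector_field M1) : vector_field M :=
  fun c x => row_mx (X c.1 (lsubmx x)) 0.

Definition vlift (U : vector_field M2) : vector_field M :=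
  fun c x => row_mx 0 (U c.2 (rsubmx x)).

Definition horizontal_lift (X : vector_field M) : Prop :=
  exists2 X1 : vector_field M1, smooth_vector_field X1 & X = hlift X1.

Definition vertical_lift (U : vector_field M) : Prop :=
  exists2 U2 : vector_field M2, smooth_vector_field U2 & U = vlift U2.

Definition pullback1 (T : tensor2 M1) : tensor2 M :=
  fun c x => block_mx (T c.1 (lsubmx x)) 0 0 0.

Definition pullback2 (T : tensor2 M2) : tensor2 M :=
  fun c x => block_mx 0 0 0 (T c.2 (rsubmx x)).

Definition twisted_metric (g1 : tensor2 M1) (f : M -> R) (g2 : tensor2 M2)
  : tensor2 M :=
  fun c x => pullback1 g1 c x + loc f c x ^+ 2 *: pullback2 g2 c x.

Definition lyra_metric (phi : M -> R) (g : tensor2 M) : tensor2 M :=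
  fun c x => loc phi c x ^+ 2 *: g c x.

(* The restriction of [h] to the slice M1 x {q}, where [q] has coordinates [z]
   in the [j]-th chart of M2. *)
Definition slice1 (h : scalar_field M) (j : idx M2) (z : 'rV[R]_n2)
  : scalar_field M1 := fun i y => h (i, j) (row_mx y z).

(* The Hessian on (M1, g1) with the M2-variable held fixed, as a tensor on M
   that vanishes on vertical vectors. *)
Definition Hess1 (g1 : tensor2 M1) (h : scalar_field M) : tensor2 M :=
  fun c x => block_mx (Hess g1 (slice1 h c.2 (rsubmx x)) c.1 (lsubmx x)) 0 0 0.

End Twisted.

(* Main.v *)
Require Import Defs.
From mathcomp Require Import all_boot all_order all_algebra.
From mathcomp Require Import all_classical all_reals all_analysis.
From mathcomp Require Import ring lra.

Set Implicit Arguments.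
Unset Strict Implicit.
Unset Printing Implicit Defensive.

Import Order.TTheory GRing.Theory Num.Theory.
Import numFieldNormedType.Exports.

Local Open Scope classical_set_scope.
Local Open Scope ring_scope.

(* In a chart, the conformal transformation formulas for the Ricci tensor and the
   Hessian turn the soliton equation into the vanishing of the symmetric matrix
     Ric + Hess u - (n-2) Hess sigma + (n-2) dsigma dsigma - du dsigma - dsigma du
       - (exp (2 sigma) Lambda - Psi) g.
   Along the splitting of the tangent space this matrix has two diagonal blocks
   and one mixed block. The Christoffel symbols of g_1 + f^2 g_2 with at least one
   horizontal lower index are those of g_1 or derivatives of ln f, which computes
   the horizontal and mixed blocks of Ric and Hess; contracting each block with
   lifts gives one of the three equations. Conversely the three equations recover
   all entries of the matrix, because a bump function extends any tangent vector
   of a factor to a global smooth vector field. *)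

(** * Smooth functions *)

(** The terms proportional to [g] in the two conformal formulas,
    [-(Delta sigma + (n-2)|nabla sigma|^2) g] for Ric and [<nabla u, nabla sigma> g] for the
    Hessian, add up to [Psi g]; this is the origin of [Psi]. The mixed equation gives only the
    horizontal-vertical block, so the converse needs the defect matrix to be symmetric, hence Ric to
    be symmetric. For Ric defined by contracting coordinate symbols this is not visible: the
    critical term is [d_j Gamma^i_ik]. Classically [Gamma^i_ik = d_k ln sqrt |det G|]; here the
    equality of the cross derivatives comes from a trace identity for the derivatives of [G] and of
    its inverse, without computing the derivative of a determinant. The vertical block is never
    expressed through [g2] and [f], since the theorem states it with Ric and Hess of [g]. In the
    other two blocks, symbols with two vertical lower indices enter only through their trace. *)

Section SmoothCalculus.
Context {R : realType}.
Implicit Types U V W : normedModType R.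

Lemma smooth_on_differentiable V W (A : set V) (h : V -> W) x :
  smooth_on A h -> A x -> differentiable h x.
Proof. by move=> /(_ 1%N)[dh _]; exact: dh. Qed.

Lemma smooth_on_derivable V W (A : set V) (h : V -> W) x v :
  smooth_on A h -> A x -> derivable h x v.
Proof. by move=> sh Ax; apply/diff_derivable/(smooth_on_differentiable sh). Qed.

Lemma smooth_on_continuous V W (A : set V) (h : V -> W) x :
  smooth_on A h -> A x -> {for x, continuous h}.
Proof. by move=> /(_ 0%N); exact. Qed.

Lemma smooth_on_derive V W (A : set V) (h : V -> W) v :
  smooth_on A h -> smooth_on A ('D_v h).
Proof. by move=> sh k; have [_] := sh k.+1; exact. Qed.

Lemma CkS V W k (A : set V) (h : V -> W) : Ck k.+1 A h -> Ck k A h.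
Proof.
elim: k h => [|k IH] h [dh Dh] /=.
  by move=> x Ax; exact/differentiable_continuous/dh.
by split=> // v; exact/IH/Dh.
Qed.

Lemma Ck_cst V W k (A : set V) (c : W) : Ck k A (fun=> c).
Proof.
elim: k c => [|k IH] c /=; first by move=> x _; exact: cvg_cst.
split=> [x _|v]; first exact: differentiable_cst.
apply: (eq_ind_r (Ck k A) (IH 0)).
by apply: funext => x; exact: derive_cst.
Qed.

Lemma smooth_on_cst V W (A : set V) (c : W) : smooth_on A (fun=> c).
Proof. by move=> k; exact: Ck_cst. Qed.

Lemma smooth_on_id V (A : set V) : smooth_on A (@id V).
Proof.
case=> [|k]; first by move=> x _; exact: cvg_id.
split=> [x _|v]; first by have [] := is_diff_id x.
apply: (eq_ind_r (Ck k A) (@Ck_cst V V k A v)).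
by apply: funext => x; exact: derive_id.
Qed.

Lemma smooth_on_ext V W (A : set V) (h h' : V -> W) :
  open A -> (forall x, A x -> h x = h' x) -> smooth_on A h -> smooth_on A h'.
Proof. by move=> oA E sh k; exact: Ck_ext (sh k). Qed.

Lemma open_ext_near V W (A : set V) (h h' : V -> W) x :
  open A -> (forall x, A x -> h x = h' x) -> A x -> \near x, h x = h' x.
Proof.
by move=> oA E Ax; near=> y; apply: E; near: y; exact: open_nbhs_nbhs.
Unshelve. all: by end_near. Qed.

Lemma derive_ext V W (A : set V) (h h' : V -> W) x v :
  open A -> (forall x, A x -> h x = h' x) -> A x -> 'D_v h x = 'D_v h' x.
Proof. by move=> oA E Ax; apply: near_eq_derive; exact: open_ext_near Ax. Qed.

(** The conditions in [Ck] concern [h] itself at single points, never its restriction to the set, so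
    they pass to unions of arbitrary sets [B]. *)
Lemma Ck_local V W k (A : set V) (h : V -> W) :
  (forall x, A x -> exists B, [/\ B x & Ck k B h]) -> Ck k A h.
Proof.
elim: k h => [|k IH] h H /=.
  by move=> x /H[B [Bx]]; exact.
split=> [x /H[B [Bx [dh _]]]|v]; first exact: dh.
by apply: IH => x /H[B [Bx [_ Dh]]]; exists B; split=> //; exact: Dh.
Qed.

Lemma smooth_on_local V W (A : set V) (h : V -> W) :
  (forall x, A x -> exists B, [/\ B x & smooth_on B h]) -> smooth_on A h.
Proof. by move=> H k; apply: Ck_local => x /H[B [? s]]; exists B. Qed.

Lemma CkM V k (A : set V) (h h' : V -> R) :
  open A -> Ck k A h -> Ck k A h' -> Ck k A (fun x => h x * h' x).
Proof.
move=> oA; elim: k h h' => [|k IH] h h'.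
  by move=> ch ch' x Ax; apply: cvgM; [exact: ch|exact: ch'].
move=> ch ch'; have [dh Dh] := ch; have [dh' Dh'] := ch'.
split=> [x Ax|v].
  by apply: differentiableM; [exact: dh|exact: dh'].
(* The Leibniz rule keeps undifferentiated factors; [CkS] lowers their order from k+1 to k so that
   the induction hypothesis applies. *)
apply: (Ck_ext oA _ (CkD oA (IH _ _ (CkS ch) (Dh' v)) (IH _ _ (CkS ch') (Dh v)))).
by move=> x Ax; rewrite !fctE deriveM //; apply: diff_derivable; [exact: dh|exact: dh'].
Qed.

Lemma smooth_onM V (A : set V) (h h' : V -> R) :
  open A -> smooth_on A h -> smooth_on A h' -> smooth_on A (fun x => h x * h' x).
Proof. by move=> oA sh sh' k; exact: CkM. Qed.

Lemma smooth_onD V W (A : set V) (h h' : V -> W) :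
  open A -> smooth_on A h -> smooth_on A h' -> smooth_on A (fun x => h x + h' x).
Proof. by move=> oA sh sh' k; exact: CkD (sh k) (sh' k). Qed.

Lemma smooth_onN V (A : set V) (h : V -> R) :
  open A -> smooth_on A h -> smooth_on A (fun x => - h x).
Proof.
move=> oA sh; apply: (smooth_on_ext oA _ (smooth_onM oA (@smooth_on_cst V R A (-1)) sh)).
by move=> x _; rewrite mulN1r.
Qed.

Lemma smooth_onB V (A : set V) (h h' : V -> R) :
  open A -> smooth_on A h -> smooth_on A h' -> smooth_on A (fun x => h x - h' x).
Proof. by move=> oA sh sh'; apply: smooth_onD => //; exact: smooth_onN. Qed.

Lemma smooth_on_sum V W (A : set V) I (r : seq I) (P : pred I) (h : I -> V -> W) :
  open A -> (forall i, smooth_on A (h i)) ->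
  smooth_on A (fun x => \sum_(i <- r | P i) h i x).
Proof.
move=> oA sh; elim: r => [|i r IH].
  by apply: (smooth_on_ext oA _ (@smooth_on_cst V W A 0)) => x _; rewrite big_nil.
case: (boolP (P i)) => Pi.
  apply: (smooth_on_ext oA _ (smooth_onD oA (sh i) IH)) => x _.
  by rewrite big_cons Pi.
by apply: (smooth_on_ext oA _ IH) => x _; rewrite big_cons (negbTE Pi).
Qed.

Lemma smooth_on_prod V (A : set V) I (r : seq I) (P : pred I) (h : I -> V -> R) :
  open A -> (forall i, smooth_on A (h i)) ->
  smooth_on A (fun x => \prod_(i <- r | P i) h i x).
Proof.
move=> oA sh; elim: r => [|i r IH].
  by apply: (smooth_on_ext oA _ (@smooth_on_cst V R A 1)) => x _; rewrite big_nil.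
case: (boolP (P i)) => Pi.
  apply: (smooth_on_ext oA _ (smooth_onM oA (sh i) IH)) => x _.
  by rewrite big_cons Pi.
by apply: (smooth_on_ext oA _ IH) => x _; rewrite big_cons (negbTE Pi).
Qed.

Lemma smooth_onX V (A : set V) (h : V -> R) m :
  open A -> smooth_on A h -> smooth_on A (fun x => h x ^+ m).
Proof.
move=> oA sh; elim: m => [|m IH]; first exact: smooth_on_cst.
apply: (smooth_on_ext oA _ (smooth_onM oA sh IH)) => x _.
by rewrite exprS.
Qed.

(** The derivative [- h^-2 Dh] contains only [h^-1] and a smooth factor, so the induction on the
    order closes on the single function [h^-1]. *)
Lemma smooth_onV V (A : set V) (h : V -> R) :
  open A -> (forall x, A x -> h x != 0) -> smooth_on A h ->
  smooth_on A (fun x => (h x)^-1).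
Proof.
move=> oA h0 sh; elim=> [|k IH].
  by move=> x Ax; apply: cvgV; [exact: h0|exact: smooth_on_continuous sh Ax].
split=> [x Ax|v].
  by apply: differentiableV; [exact: smooth_on_differentiable sh Ax|exact: h0].
have := CkM oA (CkM oA IH IH) (CkM oA (@smooth_on_cst V R A (-1) k) (smooth_on_derive v sh k)).
apply: Ck_ext => // x Ax.
rewrite deriveV; last 2 first.
- exact: h0.
- exact: smooth_on_derivable sh Ax.
by rewrite -[RHS]/(_ * _) mulN1r mulNr mulrN expr2 invfM.
Qed.

Lemma smooth_onZ V W (A : set V) (h : V -> R) (w : W) :
  open A -> smooth_on A h -> smooth_on A (fun x => h x *: w).
Proof.
move=> oA sh k; elim: k h sh => [|k IH] h sh.
  by move=> x Ax; apply: cvgZl; exact: smooth_on_continuous sh Ax.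
split=> [x Ax|v].
  by apply: differentiableZl; exact: smooth_on_differentiable sh Ax.
apply: (Ck_ext oA _ (IH _ (smooth_on_derive v sh))) => x Ax.
have dh := smooth_on_differentiable sh Ax.
by rewrite (deriveE v dh) (deriveE v (differentiableZl w dh)) diffZl.
Qed.

Lemma derive_real_comp V (p : R -> R) (h : V -> R) x v (dp : R) :
  is_derive (h x) 1 p dp -> differentiable h x ->
  differentiable (fun y => p (h y)) x /\
  'D_v (fun y => p (h y)) x = dp * 'D_v h x.
Proof.
move=> dpx dh.
have dlp : differentiable p (h x) by apply/derivable1_diffP.
have dc : differentiable (p \o h) x by exact: differentiable_comp.
split=> //; rewrite [LHS](deriveE v dc) diff_comp //=.
rewrite deriveE // -[X in 'd _ _ X]mulr1 -[X in 'd _ _ X]/(_ *: (1 : R)) linearZ /=.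
by rewrite -(deriveE _ dlp) derive_val mulrC.
Qed.

Lemma smooth_on_ln V (A : set V) (h : V -> R) :
  open A -> (forall x, A x -> 0 < h x) -> smooth_on A h ->
  smooth_on A (fun x => ln (h x)).
Proof.
move=> oA h0 sh.
have dl x v Ax := derive_real_comp v (is_derive1_ln (h0 x Ax)) (smooth_on_differentiable sh Ax).
case=> [|k].
  by move=> x Ax; apply: differentiable_continuous; exact: (dl x 0 Ax).1.
split=> [x Ax|v]; first exact: (dl x 0 Ax).1.
have hV : smooth_on A (fun x => (h x)^-1).
  by apply: smooth_onV => // x Ax; rewrite gt_eqF // h0.
apply: (Ck_ext oA _ (CkM oA (hV k) (smooth_on_derive v sh k))) => x Ax.
by rewrite (dl x v Ax).2.
Qed.

Lemma derive_entry V m n (h : V -> 'M[R]_(m, n)) x v i j :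
  differentiable h x -> ('D_v h x) i j = 'D_v (fun y => h y i j) x.
Proof. by move=> dh; rewrite derive_mx ?mxE //; exact: diff_derivable. Qed.

Lemma smooth_on_entry V m n (A : set V) (h : V -> 'M[R]_(m, n)) i j :
  open A -> smooth_on A h -> smooth_on A (fun x => h x i j).
Proof.
move=> oA sh k; elim: k h sh => [|k IH] h sh.
  move=> x Ax.
  apply: (@continuous_comp _ _ _ h (fun N : 'M[R]_(m, n) => N i j)).
    exact: smooth_on_continuous sh Ax.
  exact: coord_continuous.
split=> [x Ax|v].
  apply: (@differentiable_comp _ _ _ _ h (fun N : 'M[R]_(m, n) => N i j)).
    exact: smooth_on_differentiable sh Ax.
  exact: differentiable_coord.
apply: (Ck_ext oA _ (IH _ (smooth_on_derive v sh))) => x Ax.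
by rewrite derive_entry //; exact: smooth_on_differentiable sh Ax.
Qed.

(** Expanding in the elementary matrices [delta_mx i j] writes [h] as a finite sum of scalar
    functions times constant matrices. *)
Lemma smooth_on_matrix V m n (A : set V) (h : V -> 'M[R]_(m, n)) :
  open A -> (forall i j, smooth_on A (fun x => h x i j)) -> smooth_on A h.
Proof.
move=> oA sh.
have := smooth_on_sum (index_enum 'I_m) xpredT oA
  (fun i => smooth_on_sum (index_enum 'I_n) xpredT oA
    (fun j => smooth_onZ (delta_mx i j) oA (sh i j))).
by apply: smooth_on_ext => // x _; rewrite -matrix_sum_delta.
Qed.

Lemma derive_comp U V W (h : V -> W) (t : U -> V) x v :
  differentiable t x -> differentiable h (t x) ->
  'D_v (h \o t) x = 'D_('D_v t x) h (t x).
Proof.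
move=> dt dh; have dc : differentiable (h \o t) x by exact: differentiable_comp.
by rewrite (deriveE v dc) diff_comp //= -(deriveE v dt) (deriveE _ dh).
Qed.

Lemma derive_partials n (h : 'rV[R]_n -> R) x v :
  differentiable h x -> 'D_v h x = \sum_i v 0 i * 'D_(delta_mx 0 i) h x.
Proof.
move=> dh; rewrite (deriveE _ dh) {1}[v]row_sum_delta linear_sum.
by apply: eq_bigr => i _; rewrite linearZ /= -deriveE.
Qed.

Lemma derive_comp_row V n (h : 'rV[R]_n -> R) (t : V -> 'rV[R]_n) x v :
  differentiable t x -> differentiable h (t x) ->
  'D_v (h \o t) x = \sum_i 'D_v (fun y => t y 0 i) x * 'D_(delta_mx 0 i) h (t x).
Proof.
move=> dt dh; rewrite (derive_comp v dt dh) derive_partials //.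
by apply: eq_bigr => i _; rewrite derive_entry.
Qed.

(** The chain rule writes a directional derivative of [h \o t] as a sum of products of a derivative
    of a coordinate of [t] and a partial derivative of [h] composed with [t]. The induction keeps
    [h] arbitrary in order to apply to these partial derivatives. *)
Lemma Ck_comp V n k (A : set V) (B : set 'rV[R]_n) (h : 'rV[R]_n -> R)
    (t : V -> 'rV[R]_n) :
  open A -> open B -> (forall x, A x -> B (t x)) -> smooth_on A t ->
  smooth_on B h -> Ck k A (h \o t).
Proof.
move=> oA oB AB st; elim: k h => [|k IH] h sh.
  move=> x Ax; apply: continuous_comp; first exact: smooth_on_continuous st Ax.
  exact: smooth_on_continuous sh (AB _ Ax).
split=> [x Ax|v].
  apply: differentiable_comp; first exact: smooth_on_differentiable st Ax.
  exact: smooth_on_differentiable sh (AB _ Ax).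
have : Ck k A (\sum_(i < n) (fun x => 'D_v (fun y => t y 0 i) x *
                               ('D_(delta_mx 0 i) h \o t) x)).
  elim/big_ind : _ => [|a b|i _]; first exact: Ck_cst.
    exact: CkD.
  apply: CkM => //.
    exact: (smooth_on_derive v (smooth_on_entry 0 i oA st)).
  exact/IH/smooth_on_derive.
apply: Ck_ext => // x Ax.
rewrite derive_comp_row; first by rewrite fct_sumE.
  exact: smooth_on_differentiable st Ax.
exact: smooth_on_differentiable sh (AB _ Ax).
Qed.

Lemma smooth_on_comp V m n (A : set V) (B : set 'rV[R]_n)
    (h : 'rV[R]_n -> 'rV[R]_m) (t : V -> 'rV[R]_n) :
  open A -> open B -> (forall x, A x -> B (t x)) -> smooth_on A t ->
  smooth_on B h -> smooth_on A (h \o t).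
Proof.
move=> oA oB AB st sh; apply: smooth_on_matrix => // i j k.
exact: (Ck_comp k oA oB AB st (smooth_on_entry i j oB sh)).
Qed.

End SmoothCalculus.

(** * Symmetry of second derivatives *)

Section Schwarz.
Context {R : realType} {V : normedModType R}.
Implicit Types (A : set V) (h : V -> R) (x v w : V).

Lemma is_derive_line h x v (s : R) :
  differentiable h (x + s *: v) ->
  is_derive s 1 (fun s => h (x + s *: v)) ('D_v h (x + s *: v)).
Proof.
move=> /(diff_derivable (v := v)).
have E : (fun t : R => t^-1 *: ((h \o shift (x + s *: v)) (t *: v) - h (x + s *: v))) =
    (fun t => t^-1 *: (((fun s => h (x + s *: v)) \o shift s) (t *: 1) - h (x + s *: v))).
  apply/funext => t /=; congr (_ *: (h _ - _)).
  by rewrite -[t *: 1]/(t * 1) mulr1 scalerDl addrCA.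
by move=> dh; split; rewrite /derivable /derive -E.
Qed.

(** The mean value theorem is used twice: for the increment in direction [w], as a function of the
    position along [v], and then for ['D_v h] along [w]. All points involved lie in the closed
    parallelogram, which must be contained in [A]. *)
Lemma second_difference A h x v w (d : R) :
  smooth_on A h -> 0 <= d ->
  (forall s t : R, 0 <= s <= d -> 0 <= t <= d -> A (x + s *: v + t *: w)) ->
  exists s t : R, [/\ 0 <= s <= d, 0 <= t <= d &
    h (x + d *: v + d *: w) - h (x + d *: v) - h (x + d *: w) + h x =
    d * d * 'D_w ('D_v h) (x + s *: v + t *: w)].
Proof.
move=> sh d0 Aseg.
have dd : 0 <= d <= d by rewrite d0 lexx.
have d00 : 0 <= (0 : R) <= d by rewrite lexx d0.
pose psi (s : R) := h (x + d *: w + s *: v) - h (x + s *: v).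
have dpsi (s : R) : s \in `[0, d] ->
    is_derive s 1 psi ('D_v h (x + d *: w + s *: v) - 'D_v h (x + s *: v)).
  rewrite in_itv /= => sd.
  have A1 : A (x + d *: w + s *: v) by rewrite addrAC; exact: Aseg.
  have A2 : A (x + s *: v) by have := Aseg s 0 sd d00; rewrite scale0r addr0.
  have := is_derive_line (smooth_on_differentiable sh A1).
  have := is_derive_line (smooth_on_differentiable sh A2).
  move=> i2 i1; exact: is_deriveB.
have cpsi : {within `[0, d], continuous psi}.
  by apply: derivable_within_continuous => s /dpsi[].
have [s sd Es] := MVT_segment d0 (fun s si => dpsi s (subset_itv_oo_cc si)) cpsi.
have {}sd' : 0 <= s <= d by move: sd; rewrite in_itv.
have dchi (t : R) : t \in `[0, d] ->
    is_derive t 1 (fun t : R => 'D_v h (x + s *: v + t *: w))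
      ('D_w ('D_v h) (x + s *: v + t *: w)).
  rewrite in_itv /= => td; apply: is_derive_line.
  by apply: (smooth_on_differentiable (smooth_on_derive v sh)); exact: Aseg.
have cchi : {within `[0, d], continuous (fun t : R => 'D_v h (x + s *: v + t *: w))}.
  by apply: derivable_within_continuous => t /dchi[].
have [t td Et] := MVT_segment d0 (fun s si => dchi s (subset_itv_oo_cc si)) cchi.
exists s, t; split=> //.
rewrite !scale0r !addr0 subr0 in Et.
rewrite /psi !scale0r !addr0 subr0 (addrAC x _ (s *: v)) Et (addrAC x) in Es.
by rewrite -mulrA (mulrC d) -(mulrC _ d) -Es; ring.
Qed.

(** The second difference is unchanged when [v] and [w] are exchanged. Hence the two mixed
    derivatives agree at two, possibly different, points of any small parallelogram at [x], and both
    are continuous at [x]. *)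
Lemma schwarz A h x v w : open A -> smooth_on A h -> A x ->
  'D_w ('D_v h) x = 'D_v ('D_w h) x.
Proof.
move=> oA sh Ax; apply/eqP; rewrite -subr_eq0 -normr_le0; apply/ler_addgt0Pl => e e0.
rewrite addr0.
have e20 : 0 < e / 2 by rewrite divr_gt0.
have c1 := smooth_on_continuous (smooth_on_derive w (smooth_on_derive v sh)) Ax.
have c2 := smooth_on_continuous (smooth_on_derive v (smooth_on_derive w sh)) Ax.
move/cvgrPdist_lt : c1 => /(_ _ e20) c1; move/cvgrPdist_lt : c2 => /(_ _ e20) c2.
have nA : nbhs x A by exact: open_nbhs_nbhs.
have [r /= r0 rb] := (nbhs_ballP _ _).1 (filterI nA (filterI c1 c2)).
(* The parallelogram with sides [d v] and [d w] then lies in the open ball of radius [r]; the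
   summand 1 keeps the denominator positive and the estimate strict. *)
pose d := r / (`|v| + `|w| + 1).
have p0 : 0 < `|v| + `|w| + 1 by rewrite ltr_pwDr // addr_ge0.
have d0 : 0 < d by rewrite divr_gt0.
have seg (s t : R) : 0 <= s <= d -> 0 <= t <= d -> ball x r (x + s *: v + t *: w).
  move=> /andP[s0 sd] /andP[t0 td].
  rewrite -ball_normE /ball_ /= -addrA opprD addNKr normrN.
  rewrite (le_lt_trans (ler_normD _ _)) // !normrZ !ger0_norm //.
  apply: (@le_lt_trans _ _ (d * (`|v| + `|w|))).
    by rewrite mulrDr lerD // ler_wpM2r.
  by rewrite /d mulrAC -mulrA gtr_pMr // ltr_pdivrMr // mul1r ltrDl.
have [s [t [sd td E1]]] := second_difference (x := x) (v := v) (w := w) sh (ltW d0)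
  (fun s t sd td => (rb _ (seg s t sd td)).1).
have seg' (s' t' : R) (sd' : 0 <= s' <= d) (td' : 0 <= t' <= d) :
    ball x r (x + s' *: w + t' *: v) by rewrite addrAC; exact: seg.
have [s' [t' [sd' td' E2]]] := second_difference (x := x) (v := w) (w := v) sh (ltW d0)
  (fun s t sd td => (rb _ (seg' s t sd td)).1).
have [_ [B1 _]] := rb _ (seg s t sd td).
have [_ [_ B2]] := rb _ (seg' s' t' sd' td').
have E : 'D_w ('D_v h) (x + s *: v + t *: w) = 'D_v ('D_w h) (x + s' *: w + t' *: v).
  apply: (@mulfI _ (d * d)); first by rewrite mulf_neq0 // gt_eqF.
  apply: (etrans (esym E1)); apply: etrans E2.
  by rewrite (addrAC x (d *: w)); ring.
move: E => {E1 E2 rb} E; rewrite E in B1; move: B1 B2 {E}.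
set c := 'D_v _ (x + _ + _).
move: ('D_w _ x) ('D_v _ x) c => a b c B1 B2.
have -> : a - b = (a - c) - (b - c) by ring.
by rewrite (le_trans (ler_normB _ _)) // [leRHS](splitr e) lerD // ltW.
Qed.

End Schwarz.

(** * Bump functions and vector fields *)

Section Bump.
Context {R : realType}.

(* The functions t^-m exp (-1/t), extended by 0 to t <= 0: their span is stable
   under differentiation, which makes them all smooth. *)
Definition flat (m : nat) (t : R) : R := if 0 < t then t ^- m * expR (- t^-1) else 0.

Lemma flat_le0 m t : t <= 0 -> flat m t = 0.
Proof. by rewrite /flat; case: ltgtP. Qed.

Lemma flat_gt0 m t : 0 < t -> 0 < flat m t.
Proof. by move=> t0; rewrite /flat t0 mulr_gt0 ?expR_gt0 // invr_gt0 exprn_gt0. Qed.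

(** In terms of [y = 1/t] this is [y^(m+2) <= (m+2)! exp y], read off from the exponential series.
    The power 2 is chosen to make the derivative at the origin vanish. *)
Lemma flat_bound m : exists C : R, forall t, 0 <= flat m t <= C * `|t| ^+ 2.
Proof.
exists (m.+2`!%:R) => t; rewrite /flat; case: ltP => t0; last first.
  by rewrite lexx mulr_ge0 // exprn_ge0.
apply/andP; split; first by rewrite mulr_ge0 ?expR_ge0 // invr_ge0 exprn_ge0 // ltW.
rewrite gtr0_norm //.
have y0 : 0 <= t^-1 by rewrite invr_ge0 ltW.
have le1 : t^-1 ^+ m.+2 <= m.+2`!%:R * expR t^-1.
  rewrite mulrC -ler_pdivrMr ?ltr0n ?fact_gt0 //.
  by apply: le_trans (expR_ge1Dxn m.+1 y0); rewrite lerDr.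
rewrite expRN ler_pdivrMr ?expR_gt0 // mulrAC -ler_pdivrMr ?exprn_gt0 //.
by rewrite -!exprVn -exprD addn2.
Qed.

Lemma is_derive_flat m (t : R) :
  is_derive t (1 : R) (flat m) (flat m.+2 t - m%:R * flat m.+1 t).
Proof.
have [t0|t0|->] := ltgtP t 0.
- have -> : flat m.+2 t - m%:R * flat m.+1 t = 0.
    by rewrite !flat_le0 ?ltW // mulr0 subr0.
  apply: (near_eq_is_derive _ (is_derive_cst 0 t 1)).
  by near=> s; rewrite flat_le0 // ltW //; near: s; exact: lt_nbhsl.
- have nE : \forall s \near t, s^-1 ^+ m * expR (- s^-1) = flat m s.
    near=> s; rewrite /flat exprVn ifT //; near: s; exact: lt_nbhsr.
  apply: (near_eq_is_derive nE).
  have tn0 : t != 0 by rewrite gt_eqF.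
  have dV : is_derive t 1 (fun s : R => s^-1) (- t ^- 2).
    split; first exact: derivableV.
    by rewrite deriveV // derive_id -[RHS]mulr1.
  have dE : is_derive t 1 (fun s : R => expR (- s^-1)) (expR (- t^-1) * t ^- 2).
    have dN := is_deriveN dV.
    by have := is_derive1_comp (is_derive_expR _) dN; rewrite opprK.
  have := is_deriveM (is_deriveX m dV) dE.
  rewrite exprfctE => H; apply: (is_derive_eq H); rewrite /flat t0 -![_ *: _]/(_ * _).
  rewrite -!exprVn; case: (m) => [|l] /=; first by rewrite !mul0r; ring.
  by rewrite !exprS; ring.
- rewrite !flat_le0 // mulr0 subr0.
  (* The difference quotient at the origin is at most [C |s|] in absolute value; [|C| + 1] replaces
     [C] below as a positive divisor. *)
  have [C Cb] := flat_bound m.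
  have H : (fun s : R => s^-1 *: ((flat m \o shift 0) (s *: 1) - flat m 0)) @ 0^' --> (0 : R).
    apply/cvgrPdist_lt => e e0.
    have C0 : 0 < `|C| + 1 by rewrite ltr_pwDr.
    near=> s; rewrite /= sub0r normrN addr0 -[s *: 1]/(s * 1) mulr1 (flat_le0 _ (lexx 0)) subr0.
    have sn0 : s != 0 by near: s; exact: nbhs_dnbhs_neq.
    have sd : `|s| < e / (`|C| + 1).
      near: s; apply: dnbhs0_lt; exact: divr_gt0.
    have /andP[b0 b1] := Cb s.
    rewrite -[_ *: _]/(_ * _) normrM normfV (ger0_norm b0) mulrC ltr_pdivrMr ?normr_gt0 //.
    apply: (le_lt_trans b1); rewrite expr2 mulrA ltr_pM2r ?normr_gt0 //.
    apply: (@le_lt_trans _ _ ((`|C| + 1) * `|s|)).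
      by rewrite ler_wpM2r // (le_trans (ler_norm C)) // lerDl.
    by rewrite mulrC -ltr_pdivlMr.
  split; first by apply/cvg_ex; exists 0.
  exact: cvg_lim H.
Unshelve. all: by end_near. Qed.

(** The induction on the order keeps [m] arbitrary, because one derivative raises the index to
    [m.+1] and [m.+2]. *)
Lemma flat_comp_Ck (V : normedModType R) k m (A : set V) (q : V -> R) :
  open A -> smooth_on A q -> Ck k A (fun x => flat m (q x)).
Proof.
move=> oA sq.
have d l x v Ax := derive_real_comp v (is_derive_flat l (q x))
                     (smooth_on_differentiable sq Ax).
elim: k m => [|k IH] m.
  by move=> x Ax; apply: differentiable_continuous; exact: (d m x 0 Ax).1.
split=> [x Ax|v]; first exact: (d m x 0 Ax).1.
have := CkM oA (CkD oA (IH m.+2) (CkM oA (@Ck_cst _ V R k A (- m%:R)) (IH m.+1)))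
            (smooth_on_derive v sq k).
by apply: Ck_ext => // x Ax; rewrite (d m x v Ax).2 !fctE mulNr.
Qed.

(** The norm of row vectors is the maximum norm, which is not smooth, so the cutoff is a function of
    the squared Euclidean distance. The closed Euclidean ball [K] of radius [r / 2] lies in the open
    maximum-norm ball of radius [r]. *)
Lemma exists_bump n (A : set 'rV[R]_n) a : open A -> A a ->
  exists (b : 'rV[R]_n -> R) (K : set 'rV[R]_n),
    [/\ compact K, K `<=` A, forall x, ~ K x -> b x = 0,
        smooth_on setT b & b a = 1].
Proof.
move=> oA Aa.
have /nbhs_ballP[r /= r0 rA] : nbhs a A by exact: open_nbhs_nbhs.
pose d := (r / 2) ^+ 2.
have d0 : 0 < d by rewrite exprn_gt0 // divr_gt0.
pose q (x : 'rV[R]_n) := d - \sum_i (x 0 i - a 0 i) ^+ 2.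
have sq : smooth_on setT q.
  apply: smooth_onB; [exact: openT|exact: smooth_on_cst|].
  apply: smooth_on_sum; first exact: openT.
  move=> i; apply: smooth_onX; first exact: openT.
  apply: smooth_onB; [exact: openT| |exact: smooth_on_cst].
  by apply: (@smooth_on_entry _ _ 1 n setT id 0 i openT); exact: smooth_on_id.
pose K := [set x | 0 <= q x].
have Kr x i : K x -> `|x 0 i - a 0 i| <= r / 2.
  rewrite /K /= subr_ge0 (bigD1 i) //= => le1.
  rewrite -(ler_pXn2r (_ : (0 < 2)%N)) ?nnegrE ?divr_ge0 ?(ltW r0) // real_normK ?num_real //.
  by apply: le_trans le1; rewrite lerDl sumr_ge0 // => j _; rewrite sqr_ge0.
have qa : q a = d.
  by rewrite /q big1 ?subr0 // => i _; rewrite subrr expr0n.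
exists (fun x => flat 0 (q x) / flat 0 d), K; split.
- apply: bounded_closed_compact.
    exists (r / 2 + `|a|); split; first exact: num_real.
    move=> M ltM x Kx /=; apply: le_trans (ltW ltM).
    rewrite -(subrK a x) (le_trans (ler_normD _ _)) // lerD2r.
    rewrite [leLHS]/Num.Def.normr /= mx_normrE; apply: bigmax_le.
      by rewrite divr_ge0 // ltW.
    by move=> [i j] _ /=; rewrite !mxE !ord1; exact: Kr.
  have -> : K = q @^-1` [set t | 0 <= t] by [].
  apply: closed_comp; last exact: closed_ge.
  by move=> x _; exact: smooth_on_continuous sq I.
- move=> x Kx; apply: rA; split=> // i j; rewrite !ord1 /ball /= distrC.
  by apply: le_lt_trans (Kr _ _ Kx) _; rewrite ltr_pdivrMr // ltr_pMr // ltr1n.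
- by move=> x /negP; rewrite -ltNge => /ltW/flat_le0 ->; rewrite mul0r.
- apply: smooth_onM; [exact: openT| |exact: smooth_on_cst].
  by move=> k; apply: flat_comp_Ck => //; exact: openT.
- by rewrite qa divff // gt_eqF // flat_gt0.
Qed.

End Bump.

Section VectorField.
Context {R : realType} {n : nat}.

Section Transition.
Context {T : topologicalType}.
Implicit Types c : chart R T n.

Lemma transition_in c c' x : is_chart c -> is_chart c' ->
  transition_dom c c' x -> transition_dom c' c (transition c c' x).
Proof.
move=> h h' [cx dx]; split; first exact: chart_map_in.
by rewrite /= /transition /= chart_mapK //; exact: chart_inv_in.
Qed.

Lemma chart_inv_transition c c' x : is_chart c' ->
  transition_dom c c' x -> chart_inv c' (transition c c' x) = chart_inv c x.
Proof. by move=> h' [_ dx]; rewrite /transition /= chart_mapK. Qed.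

Lemma transition_comp c c' c'' x : is_chart c' ->
  transition_dom c c' x ->
  transition c' c'' (transition c c' x) = transition c c'' x.
Proof. by move=> h' dx; rewrite {1}/transition /= chart_inv_transition. Qed.

Lemma transition_id c x : is_chart c -> chart_cod c x -> transition c c x = x.
Proof. by move=> h cx; rewrite /transition /= chart_invK. Qed.

End Transition.

(** The field is [b v] in the chart [i0], carried to the other charts by the differentials of the
    transition maps and extended by zero. *)
Lemma exists_vector_field (M : manifold R n) (i0 : idx M) (a v : 'rV[R]_n) :
  chart_cod (charts M i0) a ->
  exists2 X : vector_field M, smooth_vector_field X & X i0 a = v.
Proof.
move=> ca; have ch i := @charts_is_chart R n M i.
set c := charts M in ca ch *.
have [b [K [cK Kc bK sb ba]]] := exists_bump (chart_cod_open (ch i0)) ca.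
have to i j : open (transition_dom (c i) (c j)).
  exact: transition_dom_open.
have st i j : smooth_on (transition_dom (c i) (c j)) (transition (c i) (c j)).
  exact: charts_smooth.
pose X : vector_field M := fun j y =>
  if `[< chart_dom (c i0) (chart_inv (c j) y) >] then
    b (transition (c j) (c i0) y) *:
      'D_v (transition (c i0) (c j)) (transition (c j) (c i0) y)
  else 0.
(* In a Hausdorff space the image of the compact set [K] is closed. A point outside the domain of
   the chart [i0] thus has a neighbourhood on which the field vanishes, which gives smoothness
   across the boundary of that domain. *)
have cKM : closed (chart_inv (c i0) @` K).
  apply: compact_closed; first exact: manifold_hausdorff.
  apply: continuous_compact => //; apply: continuous_in_subspaceT => x.
  by rewrite inE => /Kc; exact: chart_inv_continuous.
exists X; last first.
  have da : chart_dom (c i0) (chart_inv (c i0) a) by exact: chart_inv_in.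
  rewrite /X asboolT // transition_id // ba scale1r.
  (* The transition of a chart to itself is the identity only on the open codomain, which suffices
     for its derivative there. *)
  rewrite (@derive_ext _ _ _ (chart_cod (c i0)) _ id) ?derive_id //.
    exact: chart_cod_open.
  by move=> x; exact: transition_id.
split=> [j|i j x tx].
  apply: smooth_on_local => y cy.
  have [dy|ndy] := pselect (chart_dom (c i0) (chart_inv (c j) y)).
    exists (transition_dom (c j) (c i0)); split=> //.
    apply: (@smooth_on_ext _ _ _ _ (fun y => b (transition (c j) (c i0) y) *:
      'D_v (transition (c i0) (c j)) (transition (c j) (c i0) y))) => //.
      by move=> z [_ dz]; rewrite /X asboolT.
    apply: smooth_on_matrix => // k l.
    apply: (@smooth_on_ext _ _ _ _ (fun y => b (transition (c j) (c i0) y) *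
      'D_v (transition (c i0) (c j)) (transition (c j) (c i0) y) k l)) => //.
      by move=> z _; rewrite mxE.
    apply: smooth_onM => //.
      move=> m; exact: (Ck_comp m (to j i0) openT (fun _ _ => I) (st j i0) sb).
    apply: smooth_on_entry => //.
    apply: (smooth_on_comp (to j i0) (to i0 j) _ (st j i0) (smooth_on_derive v (st i0 j))).
    by move=> z; exact: transition_in.
  exists (chart_cod (c j) `&` chart_inv (c j) @^-1` ~` (chart_inv (c i0) @` K)); split.
    split=> // -[z Kz zy]; apply: ndy; rewrite -zy; apply: chart_inv_in => //; exact: Kc.
  apply: (@smooth_on_ext _ _ _ _ (fun=> 0)); last exact: smooth_on_cst.
    rewrite openE => z [cz nz]; apply: filterI.
      by apply: open_nbhs_nbhs; split => //; exact: chart_cod_open.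
    apply: (chart_inv_continuous (ch j) cz); apply: open_nbhs_nbhs; split=> //.
    exact: closed_openC.
  move=> z [cz nz]; rewrite /X; case: asboolP => // dz.
  rewrite bK ?scale0r // => Kz; apply: nz; exists (transition (c j) (c i0) z) => //.
  by rewrite chart_inv_transition.
(* The transformation law is the chain rule for the passage from [i0] to [j] through [i]; off the
   domain of [i0] both sides are zero. *)
rewrite /= /X chart_inv_transition //; case: asboolP => dx; last by rewrite derive0.
have [cx djx] := tx.
rewrite transition_comp //.
set z := transition (c i) (c i0) x.
have tzi : transition_dom (c i0) (c i) z by exact: transition_in.
have xE : transition (c i0) (c i) z = x by rewrite transition_comp ?transition_id.
have tzj : transition_dom (c i0) (c j) z.
  by case: tzi => cz _; split=> //=; rewrite /z chart_inv_transition.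
have dt : differentiable (transition (c i) (c j)) x.
  exact: smooth_on_differentiable (st i j) tx.
rewrite (deriveE _ dt) linearZ /= -(deriveE _ dt); congr (_ *: _).
have -> : 'D_v (transition (c i0) (c j)) z =
    'D_v (transition (c i) (c j) \o transition (c i0) (c i)) z.
  apply: (derive_ext v (openI (to i0 i) (to i0 j))) => // w [wi wj] /=.
  by rewrite transition_comp.
have dti : differentiable (transition (c i0) (c i)) z.
  exact: smooth_on_differentiable (st i0 i) tzi.
have dt' : differentiable (transition (c i) (c j)) (transition (c i0) (c i) z).
  by rewrite xE.
by rewrite (derive_comp v dti dt') xE.
Qed.

End VectorField.

(** * Metrics in a chart *)

Section LocalCalculus.
Context {R : realType} {n : nat} {A : set 'rV[R]_n} (oA : open A).
Implicit Types (h : 'rV[R]_n -> R) (G : 'rV[R]_n -> 'M[R]_n).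

Lemma smooth_on_partial i h : smooth_on A h -> smooth_on A (partial i h).
Proof. exact: smooth_on_derive. Qed.

Lemma partial_ext i h h' x :
  (forall y, A y -> h y = h' y) -> A x -> partial i h x = partial i h' x.
Proof. exact: derive_ext. Qed.

Lemma partialD i h h' x : smooth_on A h -> smooth_on A h' -> A x ->
  partial i (fun y => h y + h' y) x = partial i h x + partial i h' x.
Proof.
by move=> sh sh' Ax; rewrite /partial deriveD //; exact: smooth_on_derivable Ax.
Qed.

Lemma partialM i h h' x : smooth_on A h -> smooth_on A h' -> A x ->
  partial i (fun y => h y * h' y) x = partial i h x * h' x + h x * partial i h' x.
Proof.
move=> sh sh' Ax; rewrite /partial deriveM; try exact: smooth_on_derivable Ax.
by rewrite addrC mulrC.
Qed.

Lemma partial_cst (i : 'I_n) (c : R) (x : 'rV[R]_n) : partial i (fun=> c) x = 0.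
Proof. exact: derive_cst. Qed.

Lemma partialZ i (c : R) h x : smooth_on A h -> A x ->
  partial i (fun y => c * h y) x = c * partial i h x.
Proof.
by move=> sh Ax; rewrite (partialM i _ sh) ?partial_cst ?mul0r ?add0r //; exact: smooth_on_cst.
Qed.

Lemma partialN i h x : smooth_on A h -> A x ->
  partial i (fun y => - h y) x = - partial i h x.
Proof.
by move=> sh Ax; rewrite /partial deriveN //; exact: smooth_on_derivable Ax.
Qed.

Lemma partialB i h h' x : smooth_on A h -> smooth_on A h' -> A x ->
  partial i (fun y => h y - h' y) x = partial i h x - partial i h' x.
Proof. by move=> sh sh' Ax; rewrite partialD ?partialN //; exact: smooth_onN. Qed.

Lemma partial_sum i m (h : 'I_m -> 'rV[R]_n -> R) x :
  (forall k, smooth_on A (h k)) -> A x ->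
  partial i (fun y => \sum_k h k y) x = \sum_k partial i (h k) x.
Proof.
move=> sh Ax; rewrite /partial -derive_sum; last first.
  by move=> k; exact: smooth_on_derivable Ax.
by congr ('D__ _ x); apply/funext => y; rewrite fct_sumE.
Qed.

Lemma partial_ln i h x : smooth_on A h -> A x -> 0 < h x ->
  partial i h x = h x * partial i (fun y => ln (h y)) x.
Proof.
move=> sh Ax h0; rewrite /partial.
have [_ ->] := derive_real_comp (delta_mx 0 i) (is_derive1_ln h0)
                 (smooth_on_differentiable sh Ax).
by rewrite mulVKf // gt_eqF.
Qed.

Lemma partialC i j h x : smooth_on A h -> A x ->
  partial i (partial j h) x = partial j (partial i h) x.
Proof. by move=> sh Ax; exact: (schwarz _ _ oA sh Ax). Qed.

Lemma smooth_on_det m (N : 'rV[R]_n -> 'M[R]_m) :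
  (forall i j, smooth_on A (fun x => N x i j)) -> smooth_on A (fun x => \det (N x)).
Proof.
move=> sN; apply: smooth_on_sum => // s; apply: smooth_onM => //.
  exact: smooth_on_cst.
exact: smooth_on_prod.
Qed.

(** Cramer's rule: the entries are cofactors divided by the determinant. *)
Lemma smooth_on_invmx G i j : smooth_on A G ->
  (forall x, A x -> G x \in unitmx) -> smooth_on A (fun x => invmx (G x) i j).
Proof.
move=> sG uG.
have sGe k l : smooth_on A (fun x => G x k l) by exact: smooth_on_entry.
apply: (@smooth_on_ext _ _ _ _ (fun x => (\det (G x))^-1 * cofactor (G x) j i)) => //.
  by move=> x Ax; rewrite /invmx uG // !mxE.
apply: smooth_onM => //.
  apply: smooth_onV => //; last exact: smooth_on_det.
  by move=> x /uG; rewrite unitmxE unitfE.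
apply: smooth_onM => //; first exact: smooth_on_cst.
apply: smooth_on_det => k l.
by apply: smooth_on_ext (sGe (lift j k) (lift i l)) => // x _; rewrite !mxE.
Qed.

End LocalCalculus.

Lemma sum_delta_l (R : pzSemiRingType) n (j : 'I_n) (F : 'I_n -> R) :
  \sum_i (i == j)%:R * F i = F j.
Proof.
rewrite (bigD1 j) //= eqxx mul1r big1 ?addr0 // => i /negbTE ->.
by rewrite mul0r.
Qed.

Section Metric.
Context {R : realType} {n : nat} {A : set 'rV[R]_n} {G : 'rV[R]_n -> 'M[R]_n}.
Context (oA : open A) (sG : smooth_on A G)
  (symG : forall x, A x -> (G x)^T = G x)
  (uG : forall x, A x -> G x \in unitmx).
Local Notation H x := (invmx (G x)).
Local Notation Gamma := (christoffel G).

Lemma christoffelE x k i j : Gamma k i j x =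
  2^-1 * \sum_l H x k l * (partial i (fun y => G y j l) x
    + partial j (fun y => G y i l) x - partial l (fun y => G y i j) x).
Proof. by []. Qed.

Lemma metric_entryC x i j : A x -> G x i j = G x j i.
Proof. by move=> Ax; rewrite -{1}(symG Ax) mxE. Qed.

Lemma invmx_entryC x i j : A x -> H x i j = H x j i.
Proof. by move=> Ax; rewrite -{1}(symG Ax) -trmx_inv mxE. Qed.

Lemma smooth_on_metric i j : smooth_on A (fun x => G x i j).
Proof. exact: smooth_on_entry. Qed.

Lemma smooth_on_inv_metric i j : smooth_on A (fun x => H x i j).
Proof. exact: smooth_on_invmx. Qed.

Lemma smooth_on_christoffel k i j : smooth_on A (Gamma k i j).
Proof.
have sp p q r : smooth_on A (partial p (fun y => G y q r)).
  exact/smooth_on_partial/smooth_on_metric.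
apply: smooth_onM => //; first exact: smooth_on_cst.
apply: smooth_on_sum => // l; apply: smooth_onM => //.
  exact: smooth_on_inv_metric.
by apply: smooth_onB => //; exact: smooth_onD.
Qed.

Lemma partial_metricC x m i j : A x ->
  partial m (fun y => G y i j) x = partial m (fun y => G y j i) x.
Proof. by move=> Ax; apply: (partial_ext oA) => // y Ay; exact: metric_entryC. Qed.

Lemma christoffelC x k i j : A x -> Gamma k i j x = Gamma k j i x.
Proof.
move=> Ax; congr (_ * _); apply: eq_bigr => l _; congr (_ * _).
by rewrite (partial_metricC l i j) // (addrC (partial i _ x)).
Qed.

Lemma sum_metric_inv x i j : A x -> \sum_k G x i k * H x k j = (i == j)%:R.
Proof.
by move=> Ax; have := mulmxV (uG Ax) => /matrixP /(_ i j); rewrite !mxE.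
Qed.

Lemma sum_inv_metric x i j : A x -> \sum_k H x i k * G x k j = (i == j)%:R.
Proof.
by move=> Ax; have := mulVmx (uG Ax) => /matrixP /(_ i j); rewrite !mxE.
Qed.

Lemma christoffel_lower x l i j : A x ->
  \sum_k G x l k * Gamma k i j x =
  2^-1 * (partial i (fun y => G y j l) x + partial j (fun y => G y i l) x
          - partial l (fun y => G y i j) x).
Proof.
move=> Ax; pose c l := partial i (fun y => G y j l) x + partial j (fun y => G y i l) x
          - partial l (fun y => G y i j) x.
rewrite -/(c l) -[X in _ * X](sum_delta_l l c).
under eq_bigr do rewrite /christoffel mulrCA mulr_sumr.
rewrite -mulr_sumr exchange_big /=; congr (_ * _); apply: eq_bigr => p _.
rewrite eq_sym -(sum_metric_inv _ _ Ax) mulr_suml; apply: eq_bigr => k _.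
by rewrite -/(c p) mulrA.
Qed.

(** This is [nabla g = 0] in coordinates. The two sums are Christoffel symbols of the first kind,
    and in their sum all derivatives but [d_m g_ij] cancel. *)
Lemma partial_metric x m i j : A x ->
  partial m (fun y => G y i j) x =
  \sum_k (G x j k * Gamma k m i x + G x i k * Gamma k m j x).
Proof.
move=> Ax; rewrite big_split /= !christoffel_lower //.
by rewrite (partial_metricC _ j i) //; lra.
Qed.

(** This is [nabla g^-1 = 0]: differentiating [H G = 1] gives [dH = - H dG H], where
    [partial_metric] replaces [dG]. *)
Lemma partial_inv_metric x m i j : A x ->
  partial m (fun y => H y i j) x =
  - \sum_p (H x p j * Gamma i m p x + H x p i * Gamma j m p x).
Proof.
move=> Ax.
have E : forall k, \sum_l (partial m (fun y => H y i l) x * G x l k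
                        + H x i l * partial m (fun y => G y l k) x) = 0.
  move=> k; transitivity (partial m (fun y => \sum_l H y i l * G y l k) x).
    rewrite (partial_sum (A := A)) //; last first.
      by move=> l; apply: smooth_onM => //;
        [exact: smooth_on_inv_metric|exact: smooth_on_metric].
    apply: eq_bigr => l _; rewrite (partialM (A := A)) //.
      exact: smooth_on_inv_metric.
    exact: smooth_on_metric.
  transitivity (partial m (fun=> (i == k)%:R) x); last exact: partial_cst.
  by apply: (partial_ext oA) => // y Ay; exact: sum_inv_metric.
have -> : partial m (fun y => H y i j) x =
    - \sum_k \sum_l H x i l * partial m (fun y => G y l k) x * H x k j.
  apply/eqP; rewrite -addr_eq0 -(sum_delta_l j (fun l => partial m (fun y => H y i l) x)).
  apply/eqP; transitivity (\sum_k \sum_l (partial m (fun y => H y i l) x * G x l k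
                        + H x i l * partial m (fun y => G y l k) x) * H x k j); last first.
    by apply: big1 => k _; rewrite -mulr_suml E mul0r.
  under [RHS]eq_bigr => k _ do
    (under eq_bigr => l _ do rewrite mulrDl; rewrite big_split /=).
  rewrite big_split /=; congr (_ + _).
  rewrite exchange_big; apply: eq_bigr => l _ /=.
  rewrite -(sum_metric_inv _ _ Ax) mulr_suml; apply: eq_bigr => k _; ring.
congr (- _); rewrite big_split /=.
transitivity (\sum_k \sum_l \sum_p H x i l * G x l p * Gamma p m k x * H x k j
  + \sum_k \sum_l \sum_p H x k j * G x k p * Gamma p m l x * H x i l).
  rewrite -big_split; apply: eq_bigr => k _; rewrite -big_split; apply: eq_bigr => l _.
  rewrite -big_split partial_metric // mulr_sumr mulr_suml; apply: eq_bigr => p _ /=.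
  ring.
congr (_ + _).
  apply: eq_bigr => k _; rewrite exchange_big /=.
  rewrite -(sum_delta_l i (fun p => H x k j * Gamma p m k x)); apply: eq_bigr => p _.
  rewrite eq_sym -(sum_inv_metric _ _ Ax) mulr_suml; apply: eq_bigr => l _; ring.
rewrite exchange_big; apply: eq_bigr => l _; rewrite exchange_big /=.
rewrite (invmx_entryC l i) //.
rewrite -(sum_delta_l j (fun p => H x i l * Gamma p m l x)); apply: eq_bigr => p _.
rewrite eq_sym -(sum_inv_metric _ _ Ax) mulr_suml; apply: eq_bigr => k _.
by rewrite (invmx_entryC k j) //; ring.
Qed.

End Metric.

(** * Partial derivatives in product coordinates *)

Section SubmatrixDerivatives.
Context {R : realType} {n1 n2 : nat}.
Implicit Types (x v : 'rV[R]_(n1 + n2)).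

(** By linearity of [lsubmx] the two difference quotients are the same function of [t], so the
    equality also covers points where the limit fails to exist. *)
Lemma derive_lsubmx (h : 'rV[R]_n1 -> R) x v :
  'D_v (fun y => h (lsubmx y)) x = 'D_(lsubmx v) h (lsubmx x).
Proof.
have E : (fun t : R => t^-1 *: (((fun y => h (lsubmx y)) \o shift x) (t *: v) - h (lsubmx x))) =
    (fun t => t^-1 *: ((h \o shift (lsubmx x)) (t *: lsubmx v) - h (lsubmx x))).
  by apply/funext => t /=; rewrite linearP.
by rewrite /derive E.
Qed.

Lemma derive_rsubmx (h : 'rV[R]_n2 -> R) x v :
  'D_v (fun y => h (rsubmx y)) x = 'D_(rsubmx v) h (rsubmx x).
Proof.
have E : (fun t : R => t^-1 *: (((fun y => h (rsubmx y)) \o shift x) (t *: v) - h (rsubmx x))) =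
    (fun t => t^-1 *: ((h \o shift (rsubmx x)) (t *: rsubmx v) - h (rsubmx x))).
  by apply/funext => t /=; rewrite linearP.
by rewrite /derive E.
Qed.

Lemma derive_row_mx (h : 'rV[R]_(n1 + n2) -> R) (y v : 'rV[R]_n1) (z : 'rV[R]_n2) :
  'D_v (fun y => h (row_mx y z)) y = 'D_(row_mx v 0) h (row_mx y z).
Proof.
have E : (fun t : R => t^-1 *: (((fun y => h (row_mx y z)) \o shift y) (t *: v)
      - h (row_mx y z))) =
    (fun t => t^-1 *: ((h \o shift (row_mx y z)) (t *: row_mx v 0) - h (row_mx y z))).
  by apply/funext => t /=; rewrite scale_row_mx scaler0 add_row_mx add0r.
by rewrite /derive E.
Qed.

Lemma delta_lshift a : delta_mx 0 (lshift n2 a) = row_mx (delta_mx 0 a) 0 :> 'rV[R]_(n1 + n2).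
Proof.
apply/rowP => j; rewrite !mxE eqxx /=.
by case: (split_ordP j) => k -> //=; rewrite ?eq_lshift ?eq_rlshift !mxE ?eqxx.
Qed.

Lemma delta_rshift a : delta_mx 0 (rshift n1 a) = row_mx 0 (delta_mx 0 a) :> 'rV[R]_(n1 + n2).
Proof.
apply/rowP => j; rewrite !mxE eqxx /=.
by case: (split_ordP j) => k -> //=; rewrite ?eq_rshift ?eq_lrshift !mxE ?eqxx.
Qed.

Lemma partial_lsubmx_l a (h : 'rV[R]_n1 -> R) x :
  partial (lshift n2 a) (fun y => h (lsubmx y)) x = partial a h (lsubmx x).
Proof. by rewrite [LHS]derive_lsubmx delta_lshift row_mxKl. Qed.

Lemma partial_lsubmx_r a (h : 'rV[R]_n1 -> R) x :
  partial (rshift n1 a) (fun y => h (lsubmx y)) x = 0.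
Proof. by rewrite [LHS]derive_lsubmx delta_rshift row_mxKl derive0. Qed.

Lemma partial_rsubmx_l a (h : 'rV[R]_n2 -> R) x :
  partial (lshift n2 a) (fun y => h (rsubmx y)) x = 0.
Proof. by rewrite [LHS]derive_rsubmx delta_lshift row_mxKr derive0. Qed.

Lemma partial_rsubmx_r a (h : 'rV[R]_n2 -> R) x :
  partial (rshift n1 a) (fun y => h (rsubmx y)) x = partial a h (rsubmx x).
Proof. by rewrite [LHS]derive_rsubmx delta_rshift row_mxKr. Qed.

Lemma partial_row_mx a (h : 'rV[R]_(n1 + n2) -> R) y (z : 'rV[R]_n2) :
  partial a (fun y => h (row_mx y z)) y = partial (lshift n2 a) h (row_mx y z).
Proof. by rewrite [LHS]derive_row_mx -delta_lshift. Qed.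

Context {A1 : set 'rV[R]_n1} {A2 : set 'rV[R]_n2} (oA1 : open A1) (oA2 : open A2).
Local Notation A := [set x : 'rV[R]_(n1 + n2) | A1 (lsubmx x) /\ A2 (rsubmx x)].

Lemma open_prod : open A.
Proof.
rewrite [X in open X](_ : _ = lsubmx @^-1` A1 `&` rsubmx @^-1` A2) //.
apply: openI; apply: open_comp => // x _; first exact: continuous_lsubmx.
exact: continuous_rsubmx.
Qed.

Lemma smooth_on_lsubmx (h : 'rV[R]_n1 -> R) :
  smooth_on A1 h -> smooth_on A (fun y => h (lsubmx y)).
Proof.
move=> sh k; apply: (@Ck_sub _ _ _ _ _ (lsubmx @^-1` A1)); first by move=> x [].
apply: (@Ck_linear_comp _ _ _ _ _ k A1 h lsubmx idfun) => //.
  exact: continuous_lsubmx.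
by move=> ?; exact: cvg_id.
Qed.

Lemma smooth_on_rsubmx (h : 'rV[R]_n2 -> R) :
  smooth_on A2 h -> smooth_on A (fun y => h (rsubmx y)).
Proof.
move=> sh k; apply: (@Ck_sub _ _ _ _ _ (rsubmx @^-1` A2)); first by move=> x [].
apply: (@Ck_linear_comp _ _ _ _ _ k A2 h rsubmx idfun) => //.
  exact: continuous_rsubmx.
by move=> ?; exact: cvg_id.
Qed.

End SubmatrixDerivatives.

(** * Ricci curvature *)

#[local] Opaque christoffel partial derive.

(* For H the inverse of a metric G and C, D the connection matrices in two
   coordinate directions, C H + H C^T and G D + D^T G are the derivatives of - H
   and of G, so this is the symmetry of the trace of dH dG. *)
Lemma mxtrace_inv_derivatives (R : comPzRingType) n (G H C D : 'M[R]_n) :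
  G *m H = 1%:M -> H *m G = 1%:M ->
  \tr ((C *m H + H *m C^T) *m (G *m D + D^T *m G)) =
  \tr ((D *m H + H *m D^T) *m (G *m C + C^T *m G)).
Proof.
move=> GH HG.
have F X Y : \tr ((X *m H + H *m X^T) *m (G *m Y + Y^T *m G)) =
    (\tr (X *m Y) + \tr (Y *m X)) +
    (\tr (X *m H *m Y^T *m G) + \tr (Y *m H *m X^T *m G)).
  have E1 : \tr (X *m H *m (G *m Y)) = \tr (X *m Y).
    by rewrite -mulmxA (mulmxA H) HG mul1mx.
  have E2 : \tr (H *m X^T *m (Y^T *m G)) = \tr (Y *m X).
    rewrite -mulmxA mxtrace_mulC -!mulmxA GH mulmx1.
    by rewrite -mxtrace_tr trmx_mul !trmxK.
  have E3 : \tr (H *m X^T *m (G *m Y)) = \tr (Y *m H *m X^T *m G).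
    by rewrite mulmxA mxtrace_mulC !mulmxA.
  rewrite mulmxDl !mulmxDr !mxtraceD E1 E2 E3 (mulmxA (X *m H)).
  by rewrite [X in _ + X = _]addrC addrACA.
by rewrite !F (addrC (\tr (C *m D))) (addrC (\tr (C *m H *m _ *m _))).
Qed.

Section Curvature.
Context {R : realType} {n : nat} {A : set 'rV[R]_n} {G : 'rV[R]_n -> 'M[R]_n}.
Context (oA : open A) (sG : smooth_on A G)
  (symG : forall x, A x -> (G x)^T = G x)
  (uG : forall x, A x -> G x \in unitmx).
Local Notation H x := (invmx (G x)).
Local Notation Gamma := (christoffel G).

(** Classically the k-th partial derivative of [ln sqrt |det G|]. *)
Definition christoffel_trace k : 'rV[R]_n -> R := fun x => \sum_i Gamma i i k x.

Lemma christoffel_trace_sum k x : christoffel_trace k x = \sum_i Gamma i i k x.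
Proof. by []. Qed.

Lemma smooth_on_christoffel_trace k : smooth_on A (christoffel_trace k).
Proof. by apply: smooth_on_sum => // i; exact: smooth_on_christoffel. Qed.

(** Contracting [partial_metric] with the inverse metric produces the trace twice, whence the factor
    one half. *)
Lemma christoffel_traceE x k : A x ->
  christoffel_trace k x =
  2^-1 * \sum_i \sum_l H x i l * partial k (fun y => G y i l) x.
Proof.
move=> Ax.
have -> : \sum_i \sum_l H x i l * partial k (fun y => G y i l) x =
   \sum_i \sum_l \sum_p H x i l * G x l p * Gamma p k i x +
   \sum_i \sum_l \sum_p H x i l * G x i p * Gamma p k l x.
  rewrite -big_split; apply: eq_bigr => i _; rewrite -big_split; apply: eq_bigr => l _.
  rewrite -big_split (partial_metric oA) // mulr_sumr; apply: eq_bigr => p _ /=; ring.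
have E1 : \sum_i \sum_l \sum_p H x i l * G x l p * Gamma p k i x =
    christoffel_trace k x.
  apply: eq_bigr => i _; rewrite exchange_big /= (christoffelC oA symG) //.
  rewrite -(sum_delta_l i (fun p => Gamma p k i x)); apply: eq_bigr => p _.
  by rewrite eq_sym -(sum_inv_metric uG _ _ Ax) mulr_suml.
rewrite E1 [X in _ + X](_ : _ = christoffel_trace k x); first by lra.
rewrite -[RHS]E1 exchange_big; apply: eq_bigr => l _; apply: eq_bigr => i _.
by rewrite (invmx_entryC symG i l).
Qed.

(** This grouping isolates the traced symbols. Since the Christoffel symbols are symmetric below,
    every term is symmetric in [j] and [k] for formal reasons except the derivative of the trace. *)
Lemma ricciE x j k : A x ->
  ricci G x j k =
  \sum_i partial i (Gamma i j k) x - partial j (christoffel_trace k) x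
  + \sum_m christoffel_trace m x * Gamma m j k x
  - \sum_i \sum_m Gamma i j m x * Gamma m i k x.
Proof.
move=> Ax; rewrite mxE /riemann !big_split /= -!addrA; congr (_ + _).
rewrite sumrN /christoffel_trace (partial_sum (A := A)) //; last first.
  by move=> i; exact: smooth_on_christoffel.
congr (_ + _).
under eq_bigr do rewrite sumrB.
rewrite sumrB; congr (_ - _).
by rewrite exchange_big; apply: eq_bigr => m _; rewrite mulr_suml.
Qed.

(** Differentiating [christoffel_traceE] gives a term [H dd G], symmetric by equality of mixed
    partials, and a term [dH dG], symmetric by the matrix trace identity. *)
Lemma partial_christoffel_traceC x j k : A x ->
  partial j (christoffel_trace k) x = partial k (christoffel_trace j) x.
Proof.
move=> Ax.
have sp p q r : smooth_on A (partial p (fun y => G y q r)).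
  exact/smooth_on_partial/smooth_on_metric.
have E a b : partial a (christoffel_trace b) x = 2^-1 * \sum_i \sum_l
    (partial a (fun y => H y i l) x * partial b (fun y => G y i l) x
     + H x i l * partial a (partial b (fun y => G y i l)) x).
  transitivity (partial a (fun y => 2^-1 *
      \sum_i \sum_l H y i l * partial b (fun y => G y i l) y) x).
    by apply: (partial_ext oA) => // y; exact: christoffel_traceE.
  have sHp i l : smooth_on A (fun y => H y i l * partial b (fun y => G y i l) y).
    by apply: smooth_onM => //; exact: smooth_on_inv_metric.
  rewrite (partialZ (A := A)) //; last first.
    by apply: smooth_on_sum => // i; exact: smooth_on_sum.
  congr (_ * _); rewrite (partial_sum (A := A)) //; last first.
    by move=> i; exact: smooth_on_sum.
  apply: eq_bigr => i _; rewrite (partial_sum (A := A)) //.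
  apply: eq_bigr => l _; rewrite (partialM (A := A)) //.
  exact: smooth_on_inv_metric.
apply: (etrans (E j k)).
apply: (etrans _ (esym (E k j))).
clear E.
apply: (congr1 (fun z : R => 2^-1 * z)).
pose B a b := \sum_i \sum_l partial a (fun y => H y i l) x * partial b (fun y => G y i l) x.
have split2 a b : \sum_i \sum_l
    (partial a (fun y => H y i l) x * partial b (fun y => G y i l) x
     + H x i l * partial a (partial b (fun y => G y i l)) x) =
    B a b + \sum_i \sum_l H x i l * partial a (partial b (fun y => G y i l)) x.
  by rewrite -big_split; apply: eq_bigr => i _; rewrite -big_split.
apply: (etrans (split2 j k)); apply: (etrans _ (esym (split2 k j))).
apply: congr2; last first.
  apply: eq_bigr => i _; apply: eq_bigr => l _; apply: congr1.
  by apply: (partialC oA _ _ _ Ax); exact: smooth_on_metric.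
(* With the connection matrices [C a], one has [dG = G C + C^T G] and [dH = - (C H + H C^T)], so
   [B a b] becomes a trace covered by [mxtrace_inv_derivatives]. *)
pose dG a : 'M[R]_n := \matrix_(i, l) partial a (fun y => G y i l) x.
pose C a : 'M[R]_n := \matrix_(i, l) Gamma i a l x.
have dGE a : dG a = G x *m C a + (C a)^T *m G x.
  apply/matrixP => i l; rewrite !mxE (partial_metric oA) // big_split addrC.
  congr (_ + _); apply: eq_bigr => p _; rewrite !mxE // mulrC.
  by rewrite (metric_entryC symG l p).
have BE a b : B a b = - \tr ((C a *m H x + H x *m (C a)^T) *m dG b).
  rewrite /B -sumrN /mxtrace; apply: eq_bigr => i _.
  rewrite mxE -sumrN; apply: eq_bigr => l _.
  rewrite mxE [X in _ = - (_ * X)]mxE -(partial_metricC oA symG b l i Ax) -mulNr; congr (_ * _).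
  rewrite (partial_inv_metric oA) // big_split /= !mxE; congr (- (_ + _)).
    by apply: eq_bigr => p _; rewrite !mxE mulrC.
  by apply: eq_bigr => p _; rewrite !mxE (invmx_entryC symG i p).
have HG : H x *m G x = 1%:M by rewrite mulVmx // uG.
have GH : G x *m H x = 1%:M by rewrite mulmxV // uG.
rewrite !BE !dGE; apply: congr1; exact: mxtrace_inv_derivatives.
Qed.

Lemma ricciC x j k : A x -> ricci G x j k = ricci G x k j.
Proof.
move=> Ax.
have E1 : \sum_i partial i (Gamma i j k) x = \sum_i partial i (Gamma i k j) x.
  apply: eq_bigr => i _; apply: (partial_ext oA) => // y; exact: (christoffelC oA).
have E2 : \sum_m christoffel_trace m x * Gamma m j k x =
    \sum_m christoffel_trace m x * Gamma m k j x.
  by apply: eq_bigr => i _; rewrite (christoffelC oA symG _ _ _ Ax).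
have E3 : \sum_i \sum_m Gamma i j m x * Gamma m i k x =
    \sum_i \sum_m Gamma i k m x * Gamma m i j x.
  rewrite exchange_big; apply: eq_bigr => i _; apply: eq_bigr => m _.
  rewrite mulrC (christoffelC oA symG i m k Ax).
  by rewrite (christoffelC oA symG m j i Ax).
apply: (etrans (ricciE j k Ax)); apply: (etrans _ (esym (ricciE k j Ax))).
have E0 := partial_christoffel_traceC j k Ax.
pose sub (p q : R) := p - q.
exact: (congr2 sub (congr2 +%R (congr2 sub E1 E0) E2) E3).
Qed.

Lemma hessianC h x i j : smooth_on A h -> A x -> hessian G h x i j = hessian G h x j i.
Proof.
move=> sh Ax; rewrite !mxE (partialC oA _ _ sh Ax).
apply: congr1; apply: congr1; apply: eq_bigr => k _.
by rewrite (christoffelC oA symG _ _ _ Ax).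
Qed.

End Curvature.

(** * Conformal change of metric *)

#[local] Opaque invmx.

Section ConformalAlgebra.
Context {R : comPzRingType} {n : nat}.
Context (C : 'I_n -> 'I_n -> 'I_n -> R) (g : 'I_n -> 'I_n -> R) (s S : 'I_n -> R).
Context (symC : forall k i j, C k i j = C k j i) (symg : forall i j, g i j = g j i)
  (gS : forall j, \sum_m g j m * S m = s j).

(* The Christoffel symbols of exp (2 sigma) g, where s = dsigma and S is the
   gradient of sigma. *)
Definition conformal_symbol k i j :=
  C k i j + (k == i)%:R * s j + (k == j)%:R * s i - g i j * S k.
Local Notation C' := conformal_symbol.
Local Notation T k := (\sum_i C i i k).
Local Notation N := (\sum_m s m * S m).

Lemma sum_delta_r (j : 'I_n) (F : 'I_n -> R) : \sum_i (j == i)%:R * F i = F j.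
Proof. by under eq_bigr do rewrite eq_sym; exact: sum_delta_l. Qed.

(** One of the two Kronecker deltas contributes [n s]; the contribution [s] of the other is
    cancelled by the metric term. *)
Lemma conformal_symbol_trace k : \sum_i C' i i k = T k + n%:R * s k.
Proof.
rewrite sumrB !big_split /= sum_delta_l.
have -> : \sum_i g i k * S i = s k.
  by rewrite -gS; apply: eq_bigr => i _; rewrite symg.
have -> : \sum_(i < n) (i == i)%:R * s k = n%:R * s k.
  rewrite (eq_bigr (fun=> s k)) ?sumr_const ?card_ord ?mulr_natl // => i _.
  by rewrite eqxx mul1r.
by rewrite addrK.
Qed.

Lemma conformal_symbol_contract (v : 'I_n -> R) j k :
  \sum_m v m * C' m j k =
  \sum_m v m * C m j k + v j * s k + v k * s j - g j k * \sum_m v m * S m.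
Proof.
rewrite -(sum_delta_l j (fun m => v m * s k)) -(sum_delta_l k (fun m => v m * s j)).
rewrite mulr_sumr -!big_split -sumrB /=; apply: eq_bigr => m _.
by rewrite /C'; ring.
Qed.

(** Only the left factor is expanded, so that the quadratic term of the Ricci tensor can be treated
    in two passes. *)
Lemma conformal_symbol_mul (B : 'I_n -> 'I_n -> R) j :
  \sum_i \sum_m C' i j m * B m i =
  \sum_i \sum_m C i j m * B m i + \sum_m s m * B m j + s j * \sum_i B i i
  - \sum_i S i * \sum_m g j m * B m i.
Proof.
rewrite -(sum_delta_l j (fun i => \sum_m s m * B m i)) mulr_sumr.
rewrite -!big_split -sumrB /=; apply: eq_bigr => i _.
rewrite -(sum_delta_r i (fun m => s j * B m i)) !mulr_sumr.
rewrite -!big_split -sumrB /=; apply: eq_bigr => m _.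
by rewrite /C'; ring.
Qed.

(** The sums over [p] are left grouped because, by metric compatibility, the bracket is the
    derivative [d_m g_jk]; in the Ricci tensor it cancels against the divergence term. *)
Lemma conformal_symbol_quadratic j k :
  \sum_i \sum_m C' i j m * C' m i k =
  \sum_i \sum_m C i j m * C m i k + T j * s k + T k * s j
  + 2 * (\sum_m s m * C m j k)
  - \sum_m S m * (\sum_p (g k p * C p m j + g j p * C p m k))
  + (n%:R + 2) * (s j * s k) - 2 * (g j k * N).
Proof.
rewrite (conformal_symbol_mul (fun m i => C' m i k)) conformal_symbol_trace.
rewrite conformal_symbol_contract.
have -> : \sum_i \sum_m C i j m * C' m i k = \sum_i \sum_m C i j m * C m i k
    + T j * s k + \sum_m s m * C m j k - \sum_m S m * (\sum_p g k p * C p m j).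
  under eq_bigr => i _ do rewrite conformal_symbol_contract.
  rewrite sumrB !big_split /=; congr (_ + _ + _ - _).
  - by rewrite mulr_suml; apply: eq_bigr => i _; rewrite (symC _ j).
  - by apply: eq_bigr => i _; rewrite mulrC.
  - under eq_bigr => i _ do rewrite mulr_sumr.
    rewrite exchange_big; apply: eq_bigr => m _; rewrite mulr_sumr.
    apply: eq_bigr => p _ /=; rewrite (symC p j) (symg p); ring.
have -> : \sum_i S i * (\sum_m g j m * C' m i k) =
    \sum_i S i * (\sum_p g j p * C p i k) + g j k * N.
  have -> : g j k * N = \sum_i (g j i * S i) * s k - \sum_i (g k i * S i) * s j
      + g j k * N.
    by rewrite -!mulr_suml !gS; ring.
  rewrite mulr_sumr -sumrB -!big_split; apply: eq_bigr => i _ /=.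
  by rewrite conformal_symbol_contract gS (symg i k); ring.
have -> : \sum_m S m * (\sum_p (g k p * C p m j + g j p * C p m k)) =
    \sum_m S m * (\sum_p g k p * C p m j) + \sum_m S m * (\sum_p g j p * C p m k).
  rewrite -big_split; apply: eq_bigr => m _ /=.
  by rewrite big_split mulrDr.
ring.
Qed.

End ConformalAlgebra.

Section Conformal.
Context {R : realType} {n : nat} {A : set 'rV[R]_n} {G : 'rV[R]_n -> 'M[R]_n}.
Context (oA : open A) (sG : smooth_on A G)
  (symG : forall x, A x -> (G x)^T = G x)
  (uG : forall x, A x -> G x \in unitmx).
Local Notation H x := (invmx (G x)).
Local Notation Gamma := (christoffel G).

Definition sharp h (k : 'I_n) : 'rV[R]_n -> R :=
  fun x => \sum_l H x k l * partial l h x.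

Lemma sharpE h k x : sharp h k x = \sum_l H x k l * partial l h x.
Proof. by []. Qed.

Lemma smooth_on_sharp h k : smooth_on A h -> smooth_on A (sharp h k).
Proof.
move=> sh; apply: smooth_on_sum => // l; apply: smooth_onM => //.
  exact: smooth_on_inv_metric.
exact: smooth_on_partial.
Qed.

Lemma sum_metric_sharp h x j : A x -> \sum_m G x j m * sharp h m x = partial j h x.
Proof.
move=> Ax; under eq_bigr do rewrite mulr_sumr.
rewrite exchange_big -[RHS](sum_delta_r j (fun l => partial l h x)).
apply: eq_bigr => l _; rewrite -(sum_metric_inv uG _ _ Ax) mulr_suml.
by apply: eq_bigr => m _; rewrite mulrA.
Qed.

(** The conformal Ricci formula produces the Laplacian as the divergence of the gradient, whereas
    [laplacian] is the trace of the Hessian. Of the two terms in the derivative of the inverse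
    metric, one cancels the traced symbols and the other completes the Hessian. *)
Lemma divergence_sharp h x : smooth_on A h -> A x ->
  \sum_i partial i (sharp h i) x + \sum_m christoffel_trace (G := G) m x * sharp h m x =
  \tr (H x *m hessian G h x).
Proof.
move=> sh Ax.
have sp l : smooth_on A (partial l h) by exact: smooth_on_partial.
have sH k l : smooth_on A (fun y => H y k l) by exact: smooth_on_inv_metric.
have E i : partial i (sharp h i) x =
    \sum_l (H x i l * partial i (partial l h) x
      - (\sum_p (H x p l * Gamma i i p x + H x p i * Gamma l i p x)) * partial l h x).
  rewrite (partial_sum (A := A)) //; last by move=> l; exact: smooth_onM.
  apply: eq_bigr => l _; rewrite (partialM (A := A)) // (partial_inv_metric oA) //.
  by rewrite mulNr addrC.
have -> : \tr (H x *m hessian G h x) = \sum_i \sum_l H x i l * partial i (partial l h) x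
   - \sum_i \sum_l \sum_p H x p i * Gamma l i p x * partial l h x.
  rewrite -sumrB; apply: eq_bigr => i _; rewrite mxE.
  transitivity (\sum_l H x i l * partial i (partial l h) x
     - \sum_l \sum_k H x i l * Gamma k l i x * partial k h x).
    rewrite -sumrB; apply: eq_bigr => l _; rewrite (hessianC oA symG l i sh Ax) mxE.
    rewrite mulrBr mulr_sumr; apply: congr1; apply: congr1; apply: eq_bigr => k _.
    by rewrite mulrA (christoffelC oA symG k i l Ax).
  apply: congr1; apply: congr1; rewrite exchange_big; apply: eq_bigr => k _.
  apply: eq_bigr => l _; rewrite (invmx_entryC symG i l Ax).
  by rewrite (christoffelC oA symG k l i Ax).
under eq_bigr => i _ do rewrite E sumrB.
rewrite sumrB -addrA; apply: congr1.
have -> : \sum_m christoffel_trace (G := G) m x * sharp h m x =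
    \sum_i \sum_l \sum_p H x p l * Gamma i i p x * partial l h x.
  under [RHS]eq_bigr => i _ do rewrite exchange_big.
  rewrite [RHS]exchange_big; apply: eq_bigr => p _ /=.
  rewrite mulr_suml; apply: eq_bigr => i _; rewrite mulr_sumr; apply: eq_bigr => l _.
  ring.
rewrite addrC -sumrB -sumrN; apply: eq_bigr => i _.
rewrite -sumrB -sumrN; apply: eq_bigr => l _.
rewrite mulr_suml -sumrB -sumrN; apply: eq_bigr => p _; ring.
Qed.

End Conformal.

#[local] Opaque sharp christoffel_trace.

Section ConformalChange.
Context {R : realType} {n : nat} {A : set 'rV[R]_n} {G : 'rV[R]_n -> 'M[R]_n}
  {phi s : 'rV[R]_n -> R}.
Context (oA : open A) (sG : smooth_on A G)
  (symG : forall x, A x -> (G x)^T = G x)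
  (uG : forall x, A x -> G x \in unitmx)
  (sphi : smooth_on A phi) (ss : smooth_on A s)
  (phi0 : forall x, A x -> 0 < phi x)
  (dphi : forall x m, A x -> partial m phi x = phi x * partial m s x).
Local Notation H x := (invmx (G x)).
Local Notation Gamma := (christoffel G).
Local Notation G' := (fun y => phi y ^+ 2 *: G y).

Lemma smooth_on_scaled_metric : smooth_on A G'.
Proof.
apply: smooth_on_matrix => // i j.
apply: (@smooth_on_ext _ _ _ _ (fun y => phi y ^+ 2 * G y i j)) => //.
  by move=> y _; rewrite mxE.
apply: smooth_onM => //; first exact: smooth_onX.
exact: smooth_on_metric.
Qed.

Lemma scaled_metric_unit x : A x -> G' x \in unitmx.
Proof.
move=> Ax; rewrite unitmxZ ?uG // unitfE expf_neq0 // gt_eqF //; exact: phi0.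
Qed.

Lemma partial_scaled_metric x m i j : A x ->
  partial m (fun y => G' y i j) x =
  phi x ^+ 2 * (2 * partial m s x * G x i j + partial m (fun y => G y i j) x).
Proof.
move=> Ax.
transitivity (partial m (fun y => phi y * phi y * G y i j) x).
  by apply: (partial_ext oA) => // y Ay; rewrite mxE expr2.
have sG' := smooth_on_metric oA sG i j.
rewrite (partialM _ (smooth_onM oA sphi sphi) sG' Ax) (partialM _ sphi sphi Ax).
rewrite (dphi m Ax).
by ring.
Qed.

Lemma conformal_christoffel x k i j : A x ->
  christoffel G' k i j x =
  conformal_symbol (fun k i j => Gamma k i j x) (fun i j => G x i j)
    (fun i => partial i s x) (fun k => sharp (G := G) s k x) k i j.
Proof.
move=> Ax.
have p0 : phi x ^+ 2 != 0 by rewrite expf_neq0 // gt_eqF // phi0.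
(* [d] is the combination belonging to [G]. [c] is what the rule [d(phi^2) = 2 phi^2 ds] adds, once
   [phi^2] has cancelled against the inverse of the scaled metric. *)
pose c l := 2 * partial i s x * G x j l + 2 * partial j s x * G x i l
            - 2 * partial l s x * G x i j.
pose d l := partial i (fun y => G y j l) x + partial j (fun y => G y i l) x
            - partial l (fun y => G y i j) x.
have -> : christoffel G' k i j x = 2^-1 * \sum_l H x k l * (d l + c l).
  rewrite christoffelE; apply: congr1; apply: eq_bigr => l _.
  rewrite (partial_scaled_metric i j l Ax) (partial_scaled_metric j i l Ax).
  rewrite (partial_scaled_metric l i j Ax).
  rewrite invmxZ ?scaled_metric_unit // mxE.
  rewrite -mulrDr -mulrBr mulrACA mulVf // mul1r; apply: congr1.
  have aux (si sj sl gjl gil gij a b e : R) :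
    (2 * si * gjl + a) + (2 * sj * gil + b) - (2 * sl * gij + e) =
    (a + b - e) + (2 * si * gjl + 2 * sj * gil - 2 * sl * gij) by ring.
  exact: aux.
have -> : 2^-1 * \sum_l H x k l * (d l + c l) =
    2^-1 * \sum_l H x k l * d l + 2^-1 * \sum_l H x k l * c l.
  by rewrite -mulrDr -big_split; apply: congr1; apply: eq_bigr => l _; rewrite mulrDr.
rewrite /conformal_symbol christoffelE -!addrA; apply: congr1.
rewrite -(sum_inv_metric uG k i Ax) -(sum_inv_metric uG k j Ax) !mulr_suml.
rewrite sharpE [X in _ = _ + (_ - X)]mulr_sumr -sumrB -big_split mulr_sumr.
apply: eq_bigr => l _ /=.
rewrite /c (metric_entryC symG j l Ax) (metric_entryC symG i l Ax).
have aux (hkl si sj sl gjl gil gij : R) :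
    2^-1 * (hkl * (2 * si * gjl + 2 * sj * gil - 2 * sl * gij)) =
    hkl * gil * sj + (hkl * gjl * si - gij * (hkl * sl)) by field.
exact: aux.
Qed.

Lemma conformal_christoffel_trace x k : A x ->
  christoffel_trace (G := G') k x = christoffel_trace (G := G) k x + n%:R * partial k s x.
Proof.
move=> Ax; rewrite !christoffel_trace_sum.
under eq_bigr => i _ do rewrite (conformal_christoffel i i k Ax).
apply: conformal_symbol_trace.
- by move=> i j; exact: (metric_entryC symG).
- by move=> j; exact: (sum_metric_sharp uG).
Qed.

Lemma conformal_hessian h x i j : A x ->
  hessian G' h x i j = hessian G h x i j
  - partial i s x * partial j h x - partial j s x * partial i h x
  + (\sum_k partial k h x * sharp (G := G) s k x) * G x i j.
Proof.
move=> Ax; rewrite !mxE.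
under eq_bigr => k _ do rewrite (conformal_christoffel k i j Ax) mulrC.
rewrite (conformal_symbol_contract _ _ _ _ (fun k => partial k h x)).
have aux (d c c' hi hj si sj g N : R) : c = c' ->
    d - (c + hi * sj + hj * si - g * N) = d - c' - si * hj - sj * hi + N * g.
  by move=> ->; ring.
by apply: aux; apply: eq_bigr => k _; exact: mulrC.
Qed.

Lemma sum_partial_conformal_christoffel x j k : A x ->
  \sum_i partial i (christoffel G' i j k) x =
  \sum_i partial i (Gamma i j k) x
  + partial j (partial k s) x + partial k (partial j s) x
  - \sum_i sharp (G := G) s i x * partial i (fun y => G y j k) x
  - G x j k * \sum_i partial i (sharp (G := G) s i) x.
Proof.
move=> Ax.
have sp l : smooth_on A (partial l s) by exact: smooth_on_partial.
have sS l : smooth_on A (sharp (G := G) s l) by exact: smooth_on_sharp.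
have sg := smooth_on_metric oA sG j k.
have sC i : smooth_on A (Gamma i j k) by exact: smooth_on_christoffel.
rewrite -(sum_delta_l j (fun i => partial i (partial k s) x)).
rewrite -(sum_delta_l k (fun i => partial i (partial j s) x)).
rewrite mulr_sumr -!big_split -!sumrB /=; apply: eq_bigr => i _.
transitivity (partial i (fun y => Gamma i j k y + (i == j)%:R * partial k s y
    + (i == k)%:R * partial j s y - G y j k * sharp (G := G) s i y) x).
  by apply: (partial_ext oA) => // y Ay; exact: conformal_christoffel.
have sd (b : bool) l : smooth_on A (fun y => b%:R * partial l s y).
  by apply: smooth_onM => //; exact: smooth_on_cst.
have s1 := smooth_onD oA (sC i) (sd (i == j) k).
have s2 := smooth_onD oA s1 (sd (i == k) j).
have s3 := smooth_onM oA sg (sS i).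
rewrite (partialB oA _ s2 s3 Ax) (partialD _ s1 (sd (i == k) j) Ax).
rewrite (partialD _ (sC i) (sd (i == j) k) Ax) (partialM _ sg (sS i) Ax).
rewrite (partialZ _ _ (sp k) Ax) (partialZ _ _ (sp j) Ax).
have aux (a b c dg dS g S : R) : a + b + c - (dg * S + g * dS) =
    a + b + c - S * dg - g * dS by ring.
exact: aux.
Qed.

Lemma conformal_ricci x j k : A x ->
  ricci G' x j k = ricci G x j k
  - (n%:R - 2) * (hessian G s x j k - partial j s x * partial k s x)
  - (\tr (H x *m hessian G s x)
     + (n%:R - 2) * \sum_m partial m s x * sharp (G := G) s m x) * G x j k.
Proof.
move=> Ax.
have sp l : smooth_on A (partial l s) by exact: smooth_on_partial.
have ER' := ricciE oA smooth_on_scaled_metric scaled_metric_unit j k Ax.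
have ER := ricciE oA sG uG j k Ax.
have Ea := sum_partial_conformal_christoffel j k Ax.
have Eb : partial j (christoffel_trace (G := G') k) x =
    partial j (christoffel_trace (G := G) k) x + n%:R * partial j (partial k s) x.
  transitivity (partial j (fun y => christoffel_trace (G := G) k y + n%:R * partial k s y) x).
    by apply: (partial_ext oA) => // y; exact: conformal_christoffel_trace.
  have sT : smooth_on A (christoffel_trace (G := G) k) by exact: smooth_on_christoffel_trace.
  have sn : smooth_on A (fun y => n%:R * partial k s y).
    by apply: smooth_onM => //; exact: smooth_on_cst.
  by apply: (etrans (partialD j sT sn Ax)); apply: congr1; exact: (partialZ _ _ (sp k) Ax).
pose T m := christoffel_trace (G := G) m x.
pose sym := conformal_symbol (fun k i j => Gamma k i j x) (fun i j => G x i j)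
    (fun i => partial i s x) (fun k => sharp (G := G) s k x).
have Ec : \sum_m christoffel_trace (G := G') m x * christoffel G' m j k x =
   (\sum_m T m * Gamma m j k x + n%:R * \sum_m partial m s x * Gamma m j k x)
   + (T j + n%:R * partial j s x) * partial k s x
   + (T k + n%:R * partial k s x) * partial j s x
   - G x j k * (\sum_m T m * sharp (G := G) s m x
      + n%:R * \sum_m partial m s x * sharp (G := G) s m x).
  transitivity (\sum_m (T m + n%:R * partial m s x) * sym m j k).
    apply: eq_bigr => m _.
    exact: (congr2 *%R (conformal_christoffel_trace m Ax) (conformal_christoffel m j k Ax)).
  apply: (etrans (conformal_symbol_contract _ _ _ _
    (fun m => T m + n%:R * partial m s x) j k)).
  have split (F : 'I_n -> R) : \sum_m (T m + n%:R * partial m s x) * F m =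
      \sum_m T m * F m + n%:R * \sum_m partial m s x * F m.
    rewrite mulr_sumr -big_split; apply: eq_bigr => m _.
    by rewrite [RHS]/= mulrA -mulrDl.
  by rewrite (split (fun m => Gamma m j k x)) (split (fun m => sharp (G := G) s m x)).
have Ed : \sum_i \sum_m christoffel G' i j m x * christoffel G' m i k x =
    \sum_i \sum_m Gamma i j m x * Gamma m i k x
    + T j * partial k s x + T k * partial j s x
    + 2 * (\sum_m partial m s x * Gamma m j k x)
    - \sum_m sharp (G := G) s m x * partial m (fun y => G y j k) x
    + (n%:R + 2) * (partial j s x * partial k s x)
    - 2 * (G x j k * \sum_m partial m s x * sharp (G := G) s m x).
  transitivity (\sum_i \sum_m sym i j m * sym m i k).
    apply: eq_bigr => i _; apply: eq_bigr => m _.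
    exact: (congr2 *%R (conformal_christoffel i j m Ax) (conformal_christoffel m i k Ax)).
  (* Metric compatibility puts the derivative of [G] into the shape delivered by
     [conformal_symbol_quadratic]. *)
  have -> : \sum_m sharp (G := G) s m x * partial m (fun y => G y j k) x =
      \sum_m sharp (G := G) s m x *
        (\sum_p (G x k p * Gamma p m j x + G x j p * Gamma p m k x)).
    by apply: eq_bigr => m _; exact: (congr1 ( *%R _) (partial_metric oA symG uG m j k Ax)).
  apply: conformal_symbol_quadratic.
  - by move=> l i m; exact: (christoffelC oA).
  - by move=> i m; exact: (metric_entryC symG).
  - by move=> i; exact: (sum_metric_sharp uG).
have EL := divergence_sharp oA sG symG uG ss Ax.
have Eh : hessian G s x j k = partial j (partial k s) x - \sum_m partial m s x * Gamma m j k x.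
  rewrite mxE; apply: congr1; apply: congr1; apply: eq_bigr => m _; exact: mulrC.
have Ep := partialC oA k j ss Ax.
(* All sums become variables. The term [w], the derivative of [g_jk] along the gradient of [s],
   occurs in both [a'] and [d'] and cancels; [pk = p] is equality of mixed partials, and [dv + ts]
   is the Laplacian. *)
have aux (nn a b c d a' b' c' d' r r' p pk w g dv q tj tk sj sk ts N L h : R) :
    r' = a' - b' + c' - d' -> r = a - b + c - d ->
    a' = a + p + pk - w - g * dv -> b' = b + nn * p ->
    c' = (c + nn * q) + (tj + nn * sj) * sk + (tk + nn * sk) * sj - g * (ts + nn * N) ->
    d' = d + tj * sk + tk * sj + 2 * q - w + (nn + 2) * (sj * sk) - 2 * (g * N) ->
    dv + ts = L -> h = p - q -> pk = p ->
    r' = r - (nn - 2) * (h - sj * sk) - (L + (nn - 2) * N) * g.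
  by move=> -> -> -> -> -> -> <- -> ->; ring.
exact: aux ER' ER Ea Eb Ec Ed EL Eh Ep.
Qed.

End ConformalChange.

(** * Twisted products *)

Lemma partial_funext (R : realType) n (i : 'I_n) (h h' : 'rV[R]_n -> R) x :
  h =1 h' -> partial i h x = partial i h' x.
Proof. by move/funext->. Qed.

Section TwistedProduct.
Context {R : realType} {n1 n2 : nat}.
Context {A1 : set 'rV[R]_n1} {A2 : set 'rV[R]_n2} (oA1 : open A1) (oA2 : open A2).
Context {G1 : 'rV[R]_n1 -> 'M[R]_n1} (sG1 : smooth_on A1 G1)
  (symG1 : forall x, A1 x -> (G1 x)^T = G1 x)
  (uG1 : forall x, A1 x -> G1 x \in unitmx).
Context {G2 : 'rV[R]_n2 -> 'M[R]_n2} (sG2 : smooth_on A2 G2)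
  (symG2 : forall x, A2 x -> (G2 x)^T = G2 x)
  (uG2 : forall x, A2 x -> G2 x \in unitmx).
Local Notation A := [set x : 'rV[R]_(n1 + n2) | A1 (lsubmx x) /\ A2 (rsubmx x)].
Context {f k : 'rV[R]_(n1 + n2) -> R} (sf : smooth_on A f) (sk : smooth_on A k)
  (f0 : forall x, A x -> 0 < f x)
  (df : forall x m, A x -> partial m f x = f x * partial m k x).

Definition twisted_block (x : 'rV[R]_(n1 + n2)) : 'M[R]_(n1 + n2) :=
  block_mx (G1 (lsubmx x)) 0 0 (f x ^+ 2 *: G2 (rsubmx x)).
Local Notation G := twisted_block.
Local Notation Gamma := (christoffel G).
Local Notation l := (lshift n2).
Local Notation r := (rshift n1).

Lemma twisted_ll x b c : G x (l b) (l c) = G1 (lsubmx x) b c.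
Proof. exact: block_mxEul. Qed.
Lemma twisted_lr x b c : G x (l b) (r c) = 0.
Proof. by rewrite block_mxEur mxE. Qed.
Lemma twisted_rl x b c : G x (r b) (l c) = 0.
Proof. by rewrite block_mxEdl mxE. Qed.
Lemma twisted_rr x b c : G x (r b) (r c) = f x ^+ 2 * G2 (rsubmx x) b c.
Proof. by rewrite block_mxEdr mxE. Qed.

Lemma twisted_smooth : smooth_on A G.
Proof.
have oA := open_prod oA1 oA2.
apply: smooth_on_matrix => // i j.
have E0 : smooth_on A (fun=> 0 : R) by exact: smooth_on_cst.
case: (split_ordP i) => b ->; case: (split_ordP j) => c ->.
- apply: (@smooth_on_ext _ _ _ _ (fun x => G1 (lsubmx x) b c)) => //.
    by move=> x _; rewrite twisted_ll.
  exact: (smooth_on_lsubmx oA1 (smooth_on_metric oA1 sG1 b c)).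
- by apply: smooth_on_ext E0 => // x _; rewrite twisted_lr.
- by apply: smooth_on_ext E0 => // x _; rewrite twisted_rl.
- apply: (@smooth_on_ext _ _ _ _ (fun x => f x ^+ 2 * G2 (rsubmx x) b c)) => //.
    by move=> x _; rewrite twisted_rr.
  apply: smooth_onM => //; first exact: smooth_onX.
  exact: (smooth_on_rsubmx oA2 (smooth_on_metric oA2 sG2 b c)).
Qed.

Lemma twisted_sym x : A x -> (G x)^T = G x.
Proof.
by move=> [x1 x2]; rewrite tr_block_mx !trmx0 linearZ /= symG1 // symG2.
Qed.

Lemma twisted_inv x : A x -> G x \in unitmx /\
  invmx (G x) = block_mx (invmx (G1 (lsubmx x))) 0 0 (f x ^- 2 *: invmx (G2 (rsubmx x))).
Proof.
move=> Ax; have [x1 x2] := Ax.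
set K := block_mx (invmx _) _ _ _.
have KG : K *m G x = 1%:M.
  rewrite mulmx_block !mulmx0 !mul0mx !addr0 !add0r mulVmx ?uG1 //.
  rewrite -scalemxAl -scalemxAr scalerA mulVf; last first.
    by rewrite expf_neq0 // gt_eqF // f0.
  by rewrite scale1r mulVmx ?uG2 // -scalar_mx_block.
have [_ uG] := mulmx1_unit KG; split=> //.
by rewrite -[LHS]mul1mx -KG mulmxK.
Qed.

Lemma twisted_unit x : A x -> G x \in unitmx.
Proof. by case/twisted_inv. Qed.

Lemma partial_twisted_lll x a b c :
  partial (l a) (fun y => G y (l b) (l c)) x = partial a (fun y => G1 y b c) (lsubmx x).
Proof.
rewrite -(partial_lsubmx_l a (fun y => G1 y b c) x).
by apply: partial_funext => y; exact: twisted_ll.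
Qed.

Lemma partial_twisted_rll x a b c : partial (r a) (fun y => G y (l b) (l c)) x = 0.
Proof.
rewrite -(partial_lsubmx_r a (fun y => G1 y b c) x).
by apply: partial_funext => y; exact: twisted_ll.
Qed.

Lemma partial_twisted_lr x m b c : partial m (fun y => G y (l b) (r c)) x = 0.
Proof.
rewrite -(partial_cst m (0 : R) x).
by apply: partial_funext => y; exact: twisted_lr.
Qed.

Lemma partial_twisted_rl x m b c : partial m (fun y => G y (r b) (l c)) x = 0.
Proof.
rewrite -(partial_cst m (0 : R) x).
by apply: partial_funext => y; exact: twisted_rl.
Qed.

Lemma partial_twisted_rr x m b c : A x ->
  partial m (fun y => G y (r b) (r c)) x =
  f x ^+ 2 * (2 * partial m k x * G2 (rsubmx x) b c
              + partial m (fun y => G2 (rsubmx y) b c) x).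
Proof.
move=> Ax; have oA := open_prod oA1 oA2.
have sG' := smooth_on_rsubmx (A1 := A1) oA2 (smooth_on_metric oA2 sG2 b c).
transitivity (partial m (fun y => f y * f y * G2 (rsubmx y) b c) x).
  by apply: partial_funext => y; rewrite twisted_rr expr2.
rewrite (partialM m (smooth_onM oA sf sf) sG' Ax).
rewrite (partialM _ sf sf Ax) (df m Ax).
have aux (p q g dg : R) : (p * q * p + p * (p * q)) * g + p * p * dg =
   p ^+ 2 * (2 * q * g + dg) by ring.
exact: aux.
Qed.

Lemma sum_inv_twisted_l x d (F : 'I_(n1 + n2) -> R) : A x ->
  \sum_i invmx (G x) (l d) i * F i = \sum_a invmx (G1 (lsubmx x)) d a * F (l a).
Proof.
move=> Ax; rewrite (twisted_inv Ax).2 big_split_ord /= [X in _ + X]big1 ?addr0.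
  by apply: eq_bigr => a _; rewrite block_mxEul.
by move=> a _; rewrite block_mxEur mxE mul0r.
Qed.

Lemma sum_inv_twisted_r x d (F : 'I_(n1 + n2) -> R) : A x ->
  \sum_i invmx (G x) (r d) i * F i =
  \sum_a f x ^- 2 * invmx (G2 (rsubmx x)) d a * F (r a).
Proof.
move=> Ax; rewrite (twisted_inv Ax).2 big_split_ord /= [X in X + _]big1 ?add0r.
  by apply: eq_bigr => a _; rewrite block_mxEdr mxE.
by move=> a _; rewrite block_mxEdl mxE mul0r.
Qed.

(** The four lemmas from here on cover all symbols with a horizontal lower index. They say that the
    slices of [M1] are totally geodesic with connection that of [g1], and that [nabla_X U = X(k) U]
    for coordinate fields [X] horizontal and [U] vertical. *)
Lemma twisted_christoffel_lll x d b c : A x ->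
  Gamma (l d) (l b) (l c) x = christoffel G1 d b c (lsubmx x).
Proof.
move=> Ax; rewrite !christoffelE sum_inv_twisted_l //; apply: congr1.
by apply: eq_bigr => a _; rewrite !partial_twisted_lll.
Qed.

Lemma twisted_christoffel_rll x d b c : A x -> Gamma (r d) (l b) (l c) x = 0.
Proof.
move=> Ax; rewrite christoffelE sum_inv_twisted_r // big1 ?mulr0 // => a _.
by rewrite !partial_twisted_lr partial_twisted_rll subr0 addr0 mulr0.
Qed.

Lemma twisted_christoffel_llr x d b c : A x -> Gamma (l d) (l b) (r c) x = 0.
Proof.
move=> Ax; rewrite christoffelE sum_inv_twisted_l // big1 ?mulr0 // => a _.
by rewrite partial_twisted_rl partial_twisted_rll partial_twisted_lr subr0 addr0 mulr0.
Qed.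

Lemma twisted_christoffel_rlr x d b c : A x ->
  Gamma (r d) (l b) (r c) x = (d == c)%:R * partial (l b) k x.
Proof.
move=> Ax; have x2 := Ax.2.
rewrite christoffelE sum_inv_twisted_r // -(sum_inv_metric uG2 d c x2) mulr_suml mulr_sumr.
apply: eq_bigr => a _.
rewrite !partial_twisted_lr subr0 addr0 (partial_twisted_rr (l b) c a Ax).
rewrite (partial_rsubmx_l b (fun y => G2 y c a)) addr0 (metric_entryC symG2 c a x2).
have fx0 : f x ^+ 2 != 0 by rewrite expf_neq0 // gt_eqF // f0.
have aux (p h q g : R) : p != 0 -> 2^-1 * (p^-1 * h * (p * (2 * q * g))) = h * g * q.
  by move=> p0; field.
exact: aux.
Qed.

Local Notation hess1 h b c x := (partial (l b) (partial (l c) h) x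
  - \sum_d christoffel G1 d b c (lsubmx x) * partial (l d) h x).

Lemma twisted_christoffel_trace_l x c : A x ->
  christoffel_trace (G := G) (l c) x =
  christoffel_trace (G := G1) c (lsubmx x) + n2%:R * partial (l c) k x.
Proof.
move=> Ax; have oA := open_prod oA1 oA2.
rewrite !christoffel_trace_sum big_split_ord /=; apply: congr2.
  by apply: eq_bigr => a _; exact: twisted_christoffel_lll.
rewrite (eq_bigr (fun=> partial (l c) k x)); last first.
  move=> a _; rewrite (christoffelC oA twisted_sym (r a) (r a) (l c) Ax).
  by rewrite (twisted_christoffel_rlr a c a Ax) eqxx mul1r.
by rewrite sumr_const card_ord mulr_natl.
Qed.

(** The formula for the trace in terms of derivatives of the metric bypasses the symbols with three
    vertical indices. The factor [f^2] cancels against the inverse block and leaves [2 d_b k] for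
    each of the [n2] vertical directions. *)
Lemma twisted_christoffel_trace_r x b : A x ->
  christoffel_trace (G := G) (r b) x =
  n2%:R * partial (r b) k x + christoffel_trace (G := G2) b (rsubmx x).
Proof.
move=> Ax; have oA := open_prod oA1 oA2.
have fx0 : f x ^+ 2 != 0 by rewrite expf_neq0 // gt_eqF // f0.
rewrite (christoffel_traceE oA twisted_sym twisted_unit (r b) Ax).
rewrite (christoffel_traceE oA2 symG2 uG2 b Ax.2) big_split_ord /=.
rewrite [X in _ * (X + _)]big1 ?add0r; last first.
  move=> a _; rewrite (sum_inv_twisted_l a _ Ax) big1 // => d _.
  by rewrite partial_twisted_rll mulr0.
have E a : \sum_i invmx (G x) (r a) i * partial (r b) (fun y => G y (r a) i) x =
    2 * partial (r b) k x
    + \sum_d invmx (G2 (rsubmx x)) a d * partial b (fun y => G2 y a d) (rsubmx x).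
  have -> : 2 * partial (r b) k x =
      \sum_d invmx (G2 (rsubmx x)) a d * (2 * partial (r b) k x * G2 (rsubmx x) d a).
    rewrite -[LHS]mulr1 -[X in _ * X](_ : (a == a)%:R = 1); last by rewrite eqxx.
    rewrite -(sum_inv_metric uG2 a a Ax.2) mulr_sumr; apply: eq_bigr => d _.
    exact: mulrCA.
  rewrite (sum_inv_twisted_r a _ Ax) -big_split; apply: eq_bigr => d _.
  rewrite (partial_twisted_rr (r b) a d Ax) (metric_entryC symG2 a d Ax.2).
  rewrite (partial_rsubmx_r b (fun y => G2 y a d)).
  have aux (p h q dq : R) : p != 0 ->
    p^-1 * h * (p * (q + dq)) = h * q + h * dq by move=> p0; field.
  exact: aux.
rewrite (eq_bigr _ (fun a _ => E a)) big_split mulrDr sumr_const card_ord.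
by apply: congr2 => //; rewrite -mulr_natl; field.
Qed.

(** Each of the [n2] vertical directions contributes the second derivative of [k] through the
    derivative of the trace, the connection term of the Hessian through trace times symbol, and the
    product of first derivatives through the quadratic term. *)
Lemma twisted_ricci_ll x b c : A x ->
  ricci G x (l b) (l c) = ricci G1 (lsubmx x) b c
  - n2%:R * (hess1 k b c x + partial (l b) k x * partial (l c) k x).
Proof.
move=> Ax; have oA := open_prod oA1 oA2.
have ER := ricciE oA twisted_smooth twisted_unit (l b) (l c) Ax.
have ER1 := ricciE oA1 sG1 uG1 b c Ax.1.
have Ea : \sum_i partial i (Gamma i (l b) (l c)) x =
    \sum_a partial a (christoffel G1 a b c) (lsubmx x).
  rewrite big_split_ord /= [X in _ + X]big1 ?addr0; last first.
    move=> a _; rewrite -(partial_cst (r a) (0 : R) x); apply: (partial_ext oA) => // y.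
    exact: twisted_christoffel_rll.
  apply: eq_bigr => a _; rewrite -(partial_lsubmx_l a (christoffel G1 a b c)).
  by apply: (partial_ext oA) => // y; exact: twisted_christoffel_lll.
have skc : smooth_on A (partial (l c) k) by exact: smooth_on_partial.
have Eb : partial (l b) (christoffel_trace (G := G) (l c)) x =
    partial b (christoffel_trace (G := G1) c) (lsubmx x)
    + n2%:R * partial (l b) (partial (l c) k) x.
  transitivity (partial (l b) (fun y => christoffel_trace (G := G1) c (lsubmx y)
     + n2%:R * partial (l c) k y) x).
    by apply: (partial_ext oA) => // y; exact: twisted_christoffel_trace_l.
  have sT := smooth_on_lsubmx (A2 := A2) oA1 (smooth_on_christoffel_trace oA1 sG1 uG1 c).
  have sn : smooth_on A (fun y => n2%:R * partial (l c) k y).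
    by apply: smooth_onM => //; exact: smooth_on_cst.
  rewrite (partialD _ sT sn Ax) (partialZ _ _ skc Ax).
  by rewrite (partial_lsubmx_l b (christoffel_trace (G := G1) c)).
have Ec : \sum_m christoffel_trace (G := G) m x * Gamma m (l b) (l c) x =
    \sum_d christoffel_trace (G := G1) d (lsubmx x) * christoffel G1 d b c (lsubmx x)
    + n2%:R * \sum_d christoffel G1 d b c (lsubmx x) * partial (l d) k x.
  rewrite big_split_ord /= [X in _ + X]big1 ?addr0; last first.
    by move=> a _; rewrite (twisted_christoffel_rll a b c Ax) mulr0.
  rewrite mulr_sumr -big_split; apply: eq_bigr => d _.
  rewrite (twisted_christoffel_trace_l d Ax) (twisted_christoffel_lll d b c Ax).
  have aux (t q g p : R) : (t + q * p) * g = t * g + q * (g * p) by ring.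
  exact: aux.
have Ed : \sum_i \sum_m Gamma i (l b) m x * Gamma m i (l c) x =
    \sum_a \sum_d christoffel G1 a b d (lsubmx x) * christoffel G1 d a c (lsubmx x)
    + n2%:R * (partial (l b) k x * partial (l c) k x).
  rewrite big_split_ord /=; apply: congr2.
    apply: eq_bigr => a _; rewrite big_split_ord /= [X in _ + X]big1 ?addr0; last first.
      by move=> d _; rewrite (twisted_christoffel_llr a b d Ax) mul0r.
    apply: eq_bigr => d _.
    by rewrite (twisted_christoffel_lll a b d Ax) (twisted_christoffel_lll d a c Ax).
  rewrite (eq_bigr (fun=> partial (l b) k x * partial (l c) k x)); last first.
    move=> a _; rewrite big_split_ord /= [X in X + _]big1 ?add0r; last first.
      by move=> d _; rewrite (twisted_christoffel_rll a b d Ax) mul0r.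
    rewrite -[RHS](sum_delta_r a (fun=> partial (l b) k x * partial (l c) k x)).
    apply: eq_bigr => d _.
    rewrite (christoffelC oA twisted_sym (r d) (r a) (l c) Ax).
    rewrite (twisted_christoffel_rlr a b d Ax) (twisted_christoffel_rlr d c a Ax).
    rewrite (eq_sym d a).
    have aux (e : bool) (p q : R) : e%:R * p * (e%:R * q) = e%:R * (p * q).
      by case: e; rewrite ?mul1r ?mul0r.
    exact: aux.
  by rewrite sumr_const card_ord mulr_natl.
have aux (nn a p q d t h g s r' r1 pp : R) :
    r' = a - p + q - d -> r1 = a - t + g - s -> p = t + nn * h ->
    q = g + nn * pp -> forall kk, d = s + nn * kk ->
    r' = r1 - nn * (h - pp + kk).
  by move=> -> -> -> -> kk ->; ring.
rewrite Ea in ER; exact: aux ER ER1 Eb Ec _ Ed.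
Qed.

(** The divergence term gives the mixed derivative of [k] once and the derivative of the trace gives
    it [n2] times with a minus sign. The two terms without derivatives of symbols are equal ([Ec],
    [Ed]) and cancel. *)
Lemma twisted_ricci_lr x c b : A x ->
  ricci G x (l c) (r b) = - (n2%:R - 1) * partial (l c) (partial (r b) k) x.
Proof.
move=> Ax; have oA := open_prod oA1 oA2.
have ER := ricciE oA twisted_smooth twisted_unit (l c) (r b) Ax.
have skc : smooth_on A (partial (l c) k) by exact: smooth_on_partial.
have skb : smooth_on A (partial (r b) k) by exact: smooth_on_partial.
have Ea : \sum_i partial i (Gamma i (l c) (r b)) x = partial (r b) (partial (l c) k) x.
  rewrite big_split_ord /= [X in X + _]big1 ?add0r; last first.
    move=> a _; rewrite -(partial_cst (l a) (0 : R) x); apply: (partial_ext oA) => // y.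
    exact: twisted_christoffel_llr.
  rewrite -(sum_delta_l b (fun a => partial (r a) (partial (l c) k) x)).
  apply: eq_bigr => a _; rewrite -(partialZ _ _ skc Ax).
  by apply: (partial_ext oA) => // y; exact: twisted_christoffel_rlr.
have Eb : partial (l c) (christoffel_trace (G := G) (r b)) x =
    n2%:R * partial (l c) (partial (r b) k) x.
  transitivity (partial (l c) (fun y => n2%:R * partial (r b) k y
     + christoffel_trace (G := G2) b (rsubmx y)) x).
    by apply: (partial_ext oA) => // y; exact: twisted_christoffel_trace_r.
  have sT := smooth_on_rsubmx (A1 := A1) oA2 (smooth_on_christoffel_trace oA2 sG2 uG2 b).
  have sn : smooth_on A (fun y => n2%:R * partial (r b) k y).
    by apply: smooth_onM => //; exact: smooth_on_cst.
  rewrite (partialD _ sn sT Ax) (partialZ _ _ skb Ax).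
  by rewrite (partial_rsubmx_l c (christoffel_trace (G := G2) b)) addr0.
have Ec : \sum_m christoffel_trace (G := G) m x * Gamma m (l c) (r b) x =
    christoffel_trace (G := G) (r b) x * partial (l c) k x.
  rewrite big_split_ord /= [X in X + _]big1 ?add0r; last first.
    by move=> a _; rewrite (twisted_christoffel_llr a c b Ax) mulr0.
  rewrite -(sum_delta_l b (fun d => christoffel_trace (G := G) (r d) x * partial (l c) k x)).
  by apply: eq_bigr => d _; rewrite (twisted_christoffel_rlr d c b Ax) mulrCA.
have Ed : \sum_i \sum_m Gamma i (l c) m x * Gamma m i (r b) x =
    christoffel_trace (G := G) (r b) x * partial (l c) k x.
  rewrite big_split_ord /= [X in X + _]big1 ?add0r; last first.
    move=> a _; rewrite big_split_ord /= !big1 ?addr0 // => d _.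
      by rewrite (twisted_christoffel_llr a c d Ax) mul0r.
    by rewrite (twisted_christoffel_llr d a b Ax) mulr0.
  rewrite christoffel_trace_sum big_split_ord /= [X in (X + _) * _]big1 ?add0r; last first.
    by move=> a _; rewrite (twisted_christoffel_llr a a b Ax).
  rewrite mulr_suml; apply: eq_bigr => a _.
  rewrite big_split_ord /= [X in X + _]big1 ?add0r; last first.
    by move=> d _; rewrite (twisted_christoffel_rll a c d Ax) mul0r.
  rewrite -(sum_delta_r a (fun d => Gamma (r d) (r a) (r b) x * partial (l c) k x)).
  apply: eq_bigr => d _; rewrite (twisted_christoffel_rlr a c d Ax) -mulrA.
  by apply: congr1; exact: mulrC.
have Ep := partialC oA (r b) (l c) sk Ax.
have aux (nn a p q d r' p1 p2 : R) :
    r' = a - p + q - d -> a = p2 -> p = nn * p1 -> forall t, q = t -> d = t -> p2 = p1 ->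
    r' = - (nn - 1) * p1.
  by move=> -> -> -> t -> -> ->; ring.
exact: aux ER Ea Eb _ Ec Ed Ep.
Qed.

Lemma twisted_hessian_ll h x b c : A x ->
  hessian G h x (l b) (l c) = hess1 h b c x.
Proof.
move=> Ax; rewrite mxE big_split_ord /=; apply: congr1; apply: congr1.
rewrite [X in _ + X]big1 ?addr0; last first.
  by move=> a _; rewrite (twisted_christoffel_rll a b c Ax) mul0r.
by apply: eq_bigr => a _; rewrite (twisted_christoffel_lll a b c Ax).
Qed.

Lemma twisted_hessian_lr h x b c : A x ->
  hessian G h x (l b) (r c) =
  partial (l b) (partial (r c) h) x - partial (l b) k x * partial (r c) h x.
Proof.
move=> Ax; rewrite mxE big_split_ord /=; apply: congr1; apply: congr1.
rewrite [X in X + _]big1 ?add0r; last first.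
  by move=> a _; rewrite (twisted_christoffel_llr a b c Ax) mul0r.
rewrite -(sum_delta_l c (fun a => partial (l b) k x * partial (r a) h x)).
by apply: eq_bigr => a _; rewrite (twisted_christoffel_rlr a b c Ax) mulrA.
Qed.

(** Translates [Hess1], which is defined by freezing the second variable, into partial derivatives
    on the product. *)
Lemma hessian_slice (h : 'rV[R]_(n1 + n2) -> R) x b c :
  hessian G1 (fun y => h (row_mx y (rsubmx x))) (lsubmx x) b c = hess1 h b c x.
Proof.
rewrite mxE; apply: congr2.
  transitivity (partial b (fun y => partial (l c) h (row_mx y (rsubmx x))) (lsubmx x)).
    by apply: partial_funext => y; exact: partial_row_mx.
  by rewrite (partial_row_mx b (partial (l c) h)) hsubmxK.
apply: congr1; apply: eq_bigr => a _; apply: congr1.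
by rewrite (partial_row_mx a h) hsubmxK.
Qed.

End TwistedProduct.

(** * The soliton equation *)

Section BilinearSums.
Context {R : comPzRingType} {m n : nat}.
Implicit Types (v : 'rV[R]_m) (w : 'rV[R]_n) (F : 'I_m -> 'I_n -> R).

(** Coefficients are functions of two index types, so one notion serves the square diagonal blocks
    and the rectangular mixed block. *)
Definition dsum v w F : R := \sum_b \sum_c v 0 b * F b c * w 0 c.

Lemma eq_dsum v w F F' : (forall b c, F b c = F' b c) -> dsum v w F = dsum v w F'.
Proof.
by move=> E; apply: eq_bigr => b _; apply: eq_bigr => c _; rewrite E.
Qed.

Lemma dsum0 v w F : (forall b c, F b c = 0) -> dsum v w F = 0.
Proof.
by move=> E; apply: big1 => b _; apply: big1 => c _; rewrite E mulr0 mul0r.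
Qed.

Lemma dsumD v w F F' :
  dsum v w (fun b c => F b c + F' b c) = dsum v w F + dsum v w F'.
Proof.
rewrite -big_split; apply: eq_bigr => b _; rewrite -big_split; apply: eq_bigr => c _.
by rewrite mulrDr mulrDl.
Qed.

Lemma dsumZ v w a F : dsum v w (fun b c => a * F b c) = a * dsum v w F.
Proof.
rewrite mulr_sumr; apply: eq_bigr => b _; rewrite mulr_sumr; apply: eq_bigr => c _.
by rewrite mulrCA !mulrA.
Qed.

Lemma dsumB v w F F' :
  dsum v w (fun b c => F b c - F' b c) = dsum v w F - dsum v w F'.
Proof.
rewrite -mulN1r -dsumZ -dsumD; apply: eq_dsum => b c.
by rewrite mulN1r.
Qed.

Lemma dsum_mul v w (p : 'I_m -> R) (q : 'I_n -> R) :
  dsum v w (fun b c => p b * q c) = (\sum_b v 0 b * p b) * (\sum_c w 0 c * q c).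
Proof.
rewrite mulr_suml; apply: eq_bigr => b _; rewrite mulr_sumr; apply: eq_bigr => c _.
by rewrite !mulrA mulrAC.
Qed.

Lemma dsum_delta b c F : dsum (delta_mx 0 b) (delta_mx 0 c) F = F b c.
Proof.
rewrite /dsum -[RHS](sum_delta_l b (F ^~ c)); apply: eq_bigr => i _.
rewrite -(sum_delta_l c (F i)) mulr_sumr; apply: eq_bigr => j _.
by rewrite !mxE /= -mulrA [F i j * _]mulrC.
Qed.

End BilinearSums.

Section BlockBilin.
Context {R : realType} {n1 n2 : nat}.
Implicit Types (T : 'M[R]_(n1 + n2)).

Lemma bilinE n (T : 'M[R]_n) v w : bilin T v w = dsum v w (fun i j => T i j).
Proof.
rewrite /bilin mxE [RHS]exchange_big; apply: eq_bigr => j _ /=.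
by rewrite !mxE mulr_suml.
Qed.

Lemma bilin_ll T v w :
  bilin T (row_mx v 0) (row_mx w 0) = dsum v w (fun b c => T (lshift n2 b) (lshift n2 c)).
Proof.
rewrite bilinE /dsum big_split_ord /= [X in _ + X]big1 ?addr0; last first.
  by move=> i _; rewrite big1 // => j _; rewrite row_mxEr !mxE !mul0r.
apply: eq_bigr => b _; rewrite big_split_ord /= [X in _ + X]big1 ?addr0; last first.
  by move=> i _; rewrite row_mxEl row_mxEr [X in _ * X]mxE mulr0.
by apply: eq_bigr => c _; rewrite !row_mxEl.
Qed.

Lemma bilin_rr T v w :
  bilin T (row_mx 0 v) (row_mx 0 w) = dsum v w (fun b c => T (rshift n1 b) (rshift n1 c)).
Proof.
rewrite bilinE /dsum big_split_ord /= [X in X + _]big1 ?add0r; last first.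
  by move=> i _; rewrite big1 // => j _; rewrite row_mxEl !mxE !mul0r.
apply: eq_bigr => b _; rewrite big_split_ord /= [X in X + _]big1 ?add0r; last first.
  by move=> i _; rewrite row_mxEr row_mxEl [X in _ * X]mxE mulr0.
by apply: eq_bigr => c _; rewrite !row_mxEr.
Qed.

Lemma bilin_block_ul (T : 'M[R]_n1) v w :
  bilin (block_mx T 0 0 0 : 'M[R]_(n1 + n2)) (row_mx v 0) (row_mx w 0) =
  dsum v w (fun b c => T b c).
Proof. by rewrite bilin_ll; apply: eq_dsum => b c; rewrite block_mxEul. Qed.

Context {A : set 'rV[R]_(n1 + n2)}.

Lemma derive_row_l (h : 'rV[R]_(n1 + n2) -> R) x v : smooth_on A h -> A x ->
  'D_(row_mx v 0) h x = \sum_b v 0 b * partial (lshift n2 b) h x.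
Proof.
move=> sh Ax; rewrite derive_partials; last exact: smooth_on_differentiable Ax.
rewrite big_split_ord /= [X in _ + X]big1 ?addr0.
  by apply: eq_bigr => b _; rewrite row_mxEl.
by move=> b _; rewrite row_mxEr mxE mul0r.
Qed.

Lemma derive_row_r (h : 'rV[R]_(n1 + n2) -> R) x v : smooth_on A h -> A x ->
  'D_(row_mx 0 v) h x = \sum_b v 0 b * partial (rshift n1 b) h x.
Proof.
move=> sh Ax; rewrite derive_partials; last exact: smooth_on_differentiable Ax.
rewrite big_split_ord /= [X in X + _]big1 ?add0r.
  by apply: eq_bigr => b _; rewrite row_mxEr.
by move=> b _; rewrite row_mxEl mxE mul0r.
Qed.

End BlockBilin.

Section SolitonDefect.
Context {R : realType} {n : nat} {A : set 'rV[R]_n} {G : 'rV[R]_n -> 'M[R]_n}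
  {phi s : 'rV[R]_n -> R}.
Context (oA : open A) (sG : smooth_on A G)
  (symG : forall x, A x -> (G x)^T = G x)
  (uG : forall x, A x -> G x \in unitmx)
  (sphi : smooth_on A phi) (ss : smooth_on A s)
  (phi0 : forall x, A x -> 0 < phi x)
  (dphi : forall x m, A x -> partial m phi x = phi x * partial m s x).

(** An entry of the matrix in the overview; [K] stands for [exp (2 sigma) Lambda - Psi]. *)
Definition soliton_defect (h : 'rV[R]_n -> R) (K : R) x j k : R :=
  ricci G x j k + hessian G h x j k - (n%:R - 2) * hessian G s x j k
  + (n%:R - 2) * (partial j s x * partial k s x)
  - partial j h x * partial k s x - partial j s x * partial k h x - K * G x j k.

(** Transposition exchanges the two products of [dh] and [ds]; the rest is symmetric termwise. This
    transfers the mixed equation to the vertical-horizontal block. *)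
Lemma soliton_defectC h K x j k : smooth_on A h -> A x ->
  soliton_defect h K x j k = soliton_defect h K x k j.
Proof.
move=> sh Ax; rewrite /soliton_defect (ricciC oA sG symG uG j k Ax).
rewrite (hessianC oA symG j k sh Ax) (hessianC oA symG j k ss Ax).
rewrite (metric_entryC symG j k Ax).
have aux (q t c a sj sk hj hk b : R) :
    q + t - c + a * (sj * sk) - hj * sk - sj * hk - b =
    q + t - c + a * (sk * sj) - hk * sj - sk * hj - b by ring.
exact: aux.
Qed.

Lemma bilin_gradient h x : A x ->
  bilin (G x) ((\row_j partial j h x) *m invmx (G x)) ((\row_j partial j s x) *m invmx (G x)) =
  \sum_k partial k h x * sharp (G := G) s k x.
Proof.
move=> Ax; rewrite /bilin trmx_mul trmx_inv symG // -mulmxA (mulmxA (G x)) mulmxV ?uG //.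
rewrite mul1mx -mulmxA mxE; apply: eq_bigr => k _; rewrite mxE; apply: congr1.
by rewrite sharpE mxE; apply: eq_bigr => l _; rewrite !mxE.
Qed.

(** Substituting the conformal formulas for Ric and Hess and collecting all multiples of [G] in one
    coefficient yields the displayed argument of [soliton_defect]. *)
Lemma conformal_soliton h L x : A x ->
  ricci (fun y => phi y ^+ 2 *: G y) x + hessian (fun y => phi y ^+ 2 *: G y) h x
    = L *: (phi x ^+ 2 *: G x) <->
  forall j k, soliton_defect h (phi x ^+ 2 * L
    - (\sum_k partial k h x * sharp (G := G) s k x - \tr (invmx (G x) *m hessian G s x)
       - (n%:R - 2) * \sum_k partial k s x * sharp (G := G) s k x)) x j k = 0.
Proof.
move=> Ax.
have E j k : soliton_defect h (phi x ^+ 2 * L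
    - (\sum_k partial k h x * sharp (G := G) s k x - \tr (invmx (G x) *m hessian G s x)
       - (n%:R - 2) * \sum_k partial k s x * sharp (G := G) s k x)) x j k =
   ricci (fun y => phi y ^+ 2 *: G y) x j k + hessian (fun y => phi y ^+ 2 *: G y) h x j k
   - L * (phi x ^+ 2 * G x j k).
  have E1 := conformal_ricci oA sG symG uG sphi ss phi0 dphi j k Ax.
  have E2 := conformal_hessian oA sG symG uG sphi phi0 dphi h j k Ax.
  have aux (r r' h1 h' hs nn sj sk hj hk p l P N K g : R) :
      r' = r - (nn - 2) * (hs - sj * sk) - (l + (nn - 2) * N) * g ->
      h' = h1 - sj * hk - sk * hj + P * g ->
      r + h1 - (nn - 2) * hs + (nn - 2) * (sj * sk) - hj * sk - sj * hk
      - (p * K - (P - l - (nn - 2) * N)) * g = r' + h' - K * (p * g).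
    by move=> -> ->; ring.
  exact: aux E1 E2.
split=> [H j k|H].
  rewrite E; apply/eqP; rewrite subr_eq0; apply/eqP.
  by have /matrixP/(_ j k) := H; rewrite [LHS]mxE [RHS]mxE [X in _ = _ * X -> _]mxE.
apply/matrixP => j k; rewrite [LHS]mxE [RHS]mxE [X in _ = _ * X]mxE.
by apply/eqP; rewrite -subr_eq0 -E; apply/eqP; exact: H.
Qed.

End SolitonDefect.

Section TwistedSoliton.
Context {R : realType} {n1 n2 : nat}.
Context {A1 : set 'rV[R]_n1} {A2 : set 'rV[R]_n2} (oA1 : open A1) (oA2 : open A2).
Context {G1 : 'rV[R]_n1 -> 'M[R]_n1} (sG1 : smooth_on A1 G1)
  (symG1 : forall x, A1 x -> (G1 x)^T = G1 x)
  (uG1 : forall x, A1 x -> G1 x \in unitmx).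
Context {G2 : 'rV[R]_n2 -> 'M[R]_n2} (sG2 : smooth_on A2 G2)
  (symG2 : forall x, A2 x -> (G2 x)^T = G2 x)
  (uG2 : forall x, A2 x -> G2 x \in unitmx).
Local Notation A := [set x : 'rV[R]_(n1 + n2) | A1 (lsubmx x) /\ A2 (rsubmx x)].
Context {f k s h : 'rV[R]_(n1 + n2) -> R} (sf : smooth_on A f) (sk : smooth_on A k)
  (ss : smooth_on A s) (sh : smooth_on A h)
  (f0 : forall x, A x -> 0 < f x)
  (df : forall x m, A x -> partial m f x = f x * partial m k x).
Local Notation G := (twisted_block (G1 := G1) (G2 := G2) (f := f)).
Local Notation l := (lshift n2).
Local Notation r := (rshift n1).
Local Notation n := ((n1 + n2)%N%:R : R).
Local Notation slice p x := (fun y => p (row_mx y (rsubmx x))).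

Lemma dsum_derive_ll v w (p q : 'rV[R]_(n1 + n2) -> R) x :
  smooth_on A p -> smooth_on A q -> A x ->
  'D_(row_mx v 0) p x * 'D_(row_mx w 0) q x =
  dsum v w (fun b c => partial (l b) p x * partial (l c) q x).
Proof.
by move=> sp sq Ax; rewrite dsum_mul (derive_row_l v sp Ax) (derive_row_l w sq Ax).
Qed.

Lemma dsum_derive_rr v w (p q : 'rV[R]_(n1 + n2) -> R) x :
  smooth_on A p -> smooth_on A q -> A x ->
  'D_(row_mx 0 v) p x * 'D_(row_mx 0 w) q x =
  dsum v w (fun b c => partial (r b) p x * partial (r c) q x).
Proof.
by move=> sp sq Ax; rewrite dsum_mul (derive_row_r v sp Ax) (derive_row_r w sq Ax).
Qed.

Lemma dsum_derive_lr v w (p q : 'rV[R]_(n1 + n2) -> R) x :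
  smooth_on A p -> smooth_on A q -> A x ->
  'D_(row_mx v 0) p x * 'D_(row_mx 0 w) q x =
  dsum v w (fun b c => partial (l b) p x * partial (r c) q x).
Proof.
by move=> sp sq Ax; rewrite dsum_mul (derive_row_l v sp Ax) (derive_row_r w sq Ax).
Qed.

(** The components of a vertical lift depend only on the second variable, so the horizontal
    derivative does not act on them and no first-order term appears. *)
Lemma dsum_derive2_lr v (U : 'rV[R]_n2 -> 'rV[R]_n2) (p : 'rV[R]_(n1 + n2) -> R) x :
  smooth_on A2 U -> smooth_on A p -> A x ->
  'D_(row_mx v 0) (fun y => 'D_(row_mx 0 (U (rsubmx y))) p y) x =
  dsum v (U (rsubmx x)) (fun b c => partial (l b) (partial (r c) p) x).
Proof.
move=> sU sp Ax; have oA := open_prod oA1 oA2.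
pose F y := \sum_c U (rsubmx y) 0 c * partial (r c) p y.
have sUc c : smooth_on A (fun y => U (rsubmx y) 0 c).
  exact: (smooth_on_rsubmx (A1 := A1) oA2 (smooth_on_entry 0 c oA2 sU)).
have spc c : smooth_on A (partial (r c) p) by exact: smooth_on_partial.
have sUp c : smooth_on A (fun y => U (rsubmx y) 0 c * partial (r c) p y).
  exact: smooth_onM.
have sF : smooth_on A F by exact: smooth_on_sum.
transitivity ('D_(row_mx v 0) F x).
  by apply: (derive_ext _ oA _ Ax) => y Ay; exact: derive_row_r.
rewrite (derive_row_l v sF Ax); apply: eq_bigr => b _.
rewrite (partial_sum _ sUp Ax) mulr_sumr; apply: eq_bigr => c _.
rewrite (partialM _ (sUc c) (spc c) Ax) (partial_rsubmx_l b (fun z => U z 0 c)).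
by rewrite mul0r add0r mulrA mulrAC.
Qed.

(** The left side is the difference of the two sides of the horizontal equation at a point, so that
    equation is the vanishing of a contraction of the defect. *)
Lemma horizontal_defect v w K x : A x ->
  bilin (block_mx (ricci G1 (lsubmx x)) 0 0 0 : 'M[R]_(n1 + n2)) (row_mx v 0) (row_mx w 0)
  - n2%:R * (bilin (block_mx (hessian G1 (slice k x) (lsubmx x)) 0 0 0 : 'M[R]_(n1 + n2))
               (row_mx v 0) (row_mx w 0)
             + 'D_(row_mx v 0) k x * 'D_(row_mx w 0) k x)
  + bilin (block_mx (hessian G1 (slice h x) (lsubmx x)) 0 0 0 : 'M[R]_(n1 + n2))
      (row_mx v 0) (row_mx w 0)
  - (n - 2) * bilin (block_mx (hessian G1 (slice s x) (lsubmx x)) 0 0 0 : 'M[R]_(n1 + n2))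
      (row_mx v 0) (row_mx w 0)
  + (n - 2) * ('D_(row_mx v 0) s x * 'D_(row_mx w 0) s x)
  - 'D_(row_mx v 0) h x * 'D_(row_mx w 0) s x
  - 'D_(row_mx v 0) s x * 'D_(row_mx w 0) h x
  - K * bilin (block_mx (G1 (lsubmx x)) 0 0 0 : 'M[R]_(n1 + n2)) (row_mx v 0) (row_mx w 0)
  = dsum v w (fun b c => soliton_defect (G := G) (s := s) h K x (l b) (l c)).
Proof.
move=> Ax.
have aux0 (ric hk kk hh hs s2 hs' sh' gg ric' hk' kk' hh' hs1 s2' hs1' sh1' gg' N M : R) :
    ric = ric' -> hk = hk' -> kk = kk' -> hh = hh' -> hs = hs1 -> s2 = s2' ->
    hs' = hs1' -> sh' = sh1' -> gg = gg' ->
    ric - N * (hk + kk) + hh - M * hs + M * s2 - hs' - sh' - K * gg =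
    ric' - N * (hk' + kk') + hh' - M * hs1 + M * s2' - hs1' - sh1' - K * gg'.
  by do 9 move=> ->.
have ul T := @bilin_block_ul R n1 n2 T v w.
apply: (etrans (aux0 _ _ _ _ _ _ _ _ _ _ _ _ _ _ _ _ _ _ _ _
  (ul _) (ul _) (dsum_derive_ll v w sk sk Ax) (ul _) (ul _) (dsum_derive_ll v w ss ss Ax)
  (dsum_derive_ll v w sh ss Ax) (dsum_derive_ll v w ss sh Ax) (ul _))).
rewrite -dsumD -!dsumZ -dsumB -dsumD -dsumB -dsumD -!dsumB; apply: eq_dsum => b c.
rewrite !hessian_slice /soliton_defect.
rewrite (twisted_ricci_ll oA1 oA2 sG1 symG1 uG1 sG2 symG2 uG2 sf sk f0 df b c Ax).
rewrite (twisted_hessian_ll uG1 uG2 f0 h b c Ax).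
rewrite (twisted_hessian_ll uG1 uG2 f0 s b c Ax) twisted_ll.
by [].
Qed.

Lemma vertical_defect v w K x : A x ->
  bilin (ricci G x) (row_mx 0 v) (row_mx 0 w)
  + bilin (hessian G h x) (row_mx 0 v) (row_mx 0 w)
  - (n - 2) * bilin (hessian G s x) (row_mx 0 v) (row_mx 0 w)
  + (n - 2) * ('D_(row_mx 0 v) s x * 'D_(row_mx 0 w) s x)
  - 'D_(row_mx 0 v) h x * 'D_(row_mx 0 w) s x
  - 'D_(row_mx 0 v) s x * 'D_(row_mx 0 w) h x
  - f x ^+ 2 * K * bilin (block_mx 0 0 0 (G2 (rsubmx x)) : 'M[R]_(n1 + n2))
      (row_mx 0 v) (row_mx 0 w)
  = dsum v w (fun b c => soliton_defect (G := G) (s := s) h K x (r b) (r c)).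
Proof.
move=> Ax.
rewrite !bilin_rr (dsum_derive_rr v w ss ss Ax).
rewrite (dsum_derive_rr v w sh ss Ax) (dsum_derive_rr v w ss sh Ax).
rewrite -!dsumZ -dsumD -dsumB -dsumD -!dsumB; apply: eq_dsum => b c.
rewrite /soliton_defect twisted_rr block_mxEdr.
by apply: congr1; apply: congr1; rewrite mulrCA mulrA mulrAC.
Qed.

(** The coefficient [K] appears only on the right: it multiplies a mixed entry of [G], which is
    zero. The field [U] is kept as a function because [X(U(h))] differentiates it. *)
Lemma mixed_defect v (U : 'rV[R]_n2 -> 'rV[R]_n2) K x : smooth_on A2 U -> A x ->
  - (n2%:R - 1) * 'D_(row_mx v 0) (fun y => 'D_(row_mx 0 (U (rsubmx y))) k y) x
  + 'D_(row_mx v 0) (fun y => 'D_(row_mx 0 (U (rsubmx y))) h y) x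
  - 'D_(row_mx v 0) k x * 'D_(row_mx 0 (U (rsubmx x))) h x
  - (n - 2) * ('D_(row_mx v 0) (fun y => 'D_(row_mx 0 (U (rsubmx y))) s y) x
               - 'D_(row_mx v 0) k x * 'D_(row_mx 0 (U (rsubmx x))) s x)
  + (n - 2) * ('D_(row_mx v 0) s x * 'D_(row_mx 0 (U (rsubmx x))) s x)
  - 'D_(row_mx v 0) h x * 'D_(row_mx 0 (U (rsubmx x))) s x
  - 'D_(row_mx v 0) s x * 'D_(row_mx 0 (U (rsubmx x))) h x
  = dsum v (U (rsubmx x)) (fun b c => soliton_defect (G := G) (s := s) h K x (l b) (r c)).
Proof.
move=> sU Ax.
rewrite (dsum_derive2_lr v sU sk Ax) (dsum_derive2_lr v sU sh Ax) (dsum_derive2_lr v sU ss Ax).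
move: (U _) => w.
rewrite (dsum_derive_lr v w sk sh Ax) (dsum_derive_lr v w sk ss Ax).
rewrite (dsum_derive_lr v w ss ss Ax) (dsum_derive_lr v w sh ss Ax).
rewrite (dsum_derive_lr v w ss sh Ax).
rewrite -!dsumZ -dsumD -dsumB -dsumB -dsumZ -dsumB -dsumD -!dsumB; apply: eq_dsum => b c.
rewrite /soliton_defect.
rewrite (twisted_ricci_lr oA1 oA2 sG1 symG1 uG1 sG2 symG2 uG2 sf sk f0 df b c Ax).
rewrite (twisted_hessian_lr oA1 oA2 uG1 sG2 symG2 uG2 sf f0 df h b c Ax).
rewrite (twisted_hessian_lr oA1 oA2 uG1 sG2 symG2 uG2 sf f0 df s b c Ax) twisted_lr mulr0 subr0.
have aux (a b' c' d e p q : R) :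
    a + b' - c' - d + e - p - q = a + (b' - c') - d + e - p - q by rewrite addrA.
exact: aux.
Qed.

End TwistedSoliton.

Theorem theorem3p3 (R : realType) (n1 n2 : nat)
  (M1 : manifold R n1) (M2 : manifold R n2)
  (g1 : tensor2 M1) (g2 : tensor2 M2)
  (f phi u lambda : prod_manifold M1 M2 -> R) (rho : R) :
  (0 < n1)%N -> (0 < n2)%N ->
  pseudo_riemannian g1 -> pseudo_riemannian g2 ->
  smooth_fun f -> (forall p, 0 < f p) ->
  smooth_fun phi -> (forall p, 0 < phi p) ->
  smooth_fun u -> smooth_fun lambda ->
  let M := prod_manifold M1 M2 in
  let n : R := (n1 + n2)%:R in
  let g := twisted_metric g1 f g2 in
  let gL := lyra_metric phi g in
  let k : scalar_field M := loc (fun p => ln (f p)) in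
  let sigma : scalar_field M := loc (fun p => ln (phi p)) in
  let u' : scalar_field M := loc u in
  let Lambda : scalar_field M := fun c x =>
    loc lambda c x + rho * scalar_curvature gL c x in
  let Psi : scalar_field M := fun c x =>
    evalT g (gradient g u') (gradient g sigma) c x
    - laplacian g sigma c x
    - (n - 2) * evalT g (gradient g sigma) (gradient g sigma) c x in
  gradient_almost_RB_soliton gL u lambda rho <->
  [/\ forall X Y : vector_field M, horizontal_lift X -> horizontal_lift Y ->
      forall c x, chart_cod (charts M c) x ->
        evalT (pullback1 (Ric g1)) X Y c x
        - n2%:R * (evalT (Hess1 g1 k) X Y c x + vder X k c x * vder Y k c x)
        + evalT (Hess1 g1 u') X Y c x
        - (n - 2) * evalT (Hess1 g1 sigma) X Y c x
        + (n - 2) * (vder X sigma c x * vder Y sigma c x)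
        - vder X u' c x * vder Y sigma c x
        - vder X sigma c x * vder Y u' c x
        = (expR (2 * sigma c x) * Lambda c x - Psi c x)
          * evalT (pullback1 g1) X Y c x,
      forall U V : vector_field M, vertical_lift U -> vertical_lift V ->
      forall c x, chart_cod (charts M c) x ->
        evalT (Ric g) U V c x
        + evalT (Hess g u') U V c x
        - (n - 2) * evalT (Hess g sigma) U V c x
        + (n - 2) * (vder U sigma c x * vder V sigma c x)
        - vder U u' c x * vder V sigma c x
        - vder U sigma c x * vder V u' c x
        = loc f c x ^+ 2 * (expR (2 * sigma c x) * Lambda c x - Psi c x)
          * evalT (pullback2 g2) U V c x
    & forall X U : vector_field M, horizontal_lift X -> vertical_lift U ->
      forall c x, chart_cod (charts M c) x ->
        0 = - (n2%:R - 1) * vder X (vder U k) c x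
            + vder X (vder U u') c x
            - vder X k c x * vder U u' c x
            - (n - 2) * (vder X (vder U sigma) c x
                         - vder X k c x * vder U sigma c x)
            + (n - 2) * (vder X sigma c x * vder U sigma c x)
            - vder X u' c x * vder U sigma c x
            - vder X sigma c x * vder U u' c x].
Proof.
move=> _ _ pg1 pg2 sf f0 sphi phi0 su _ M n g gL k sigma u' Lambda Psi.
pose A (c : idx M) := chart_cod (charts M c).
have oA1 i : open (chart_cod (charts M1 i)) by exact/chart_cod_open/charts_is_chart.
have oA2 j : open (chart_cod (charts M2 j)) by exact/chart_cod_open/charts_is_chart.
have oA c : open (A c) by exact/chart_cod_open/(@charts_is_chart _ _ M).
have sG1 := metric_smooth pg1; have sG2 := metric_smooth pg2.
have yG1 := Defs.metric_sym pg1; have yG2 := Defs.metric_sym pg2.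
have uG1 := metric_nondegenerate pg1; have uG2 := metric_nondegenerate pg2.
have ss c : smooth_on (A c) (sigma c).
  apply: (smooth_on_ln (oA c) _ (sphi c)) => x _; exact: phi0.
have sk c : smooth_on (A c) (k c).
  apply: (smooth_on_ln (oA c) _ (sf c)) => x _; exact: f0.
have f0c c x : A c x -> 0 < loc f c x by move=> _; exact: f0.
have phi0c c x : A c x -> 0 < loc phi c x by move=> _; exact: phi0.
have df c x m : A c x -> partial m (loc f c) x = loc f c x * partial m (k c) x.
  by move=> Ax; exact: (partial_ln m (sf c) Ax (f0c c x Ax)).
have dphi c x m : A c x -> partial m (loc phi c) x = loc phi c x * partial m (sigma c) x.
  by move=> Ax; exact: (partial_ln m (sphi c) Ax (phi0c c x Ax)).
pose G c := twisted_block (G1 := g1 c.1) (G2 := g2 c.2) (f := loc f c).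
have gE c : g c = G c.
  apply/funext => x; rewrite /g /twisted_metric /pullback1 /pullback2 /G /twisted_block.
  by rewrite scale_block_mx add_block_mx !scaler0 !addr0 !add0r.
have sG c : smooth_on (A c) (G c).
  exact: (twisted_smooth (oA1 c.1) (oA2 c.2) (sG1 c.1) (sG2 c.2) (sf c)).
have yG c x : A c x -> (G c x)^T = G c x.
  exact: (twisted_sym (yG1 c.1) (yG2 c.2) (f := loc f c)).
have uG c x : A c x -> G c x \in unitmx.
  exact: (twisted_unit (uG1 c.1) (uG2 c.2) (f0c c)).
pose K c x := expR (2 * sigma c x) * Lambda c x - Psi c x.
pose D c x := soliton_defect (G := G c) (s := sigma c) (u' c) (K c x) x.
(* Pointwise in a chart, the soliton equation is the vanishing of all entries of the defect. *)
have key c x : A c x ->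
    Ric gL c x + Hess gL (loc u) c x = Lambda c x *: gL c x <->
    forall a b, D c x a b = 0.
  move=> Ax.
  have KE : K c x = loc phi c x ^+ 2 * Lambda c x
     - (\sum_a partial a (u' c) x * sharp (G := G c) (sigma c) a x
        - \tr (invmx (G c x) *m hessian (G c) (sigma c) x)
        - (n - 2) * \sum_a partial a (sigma c) x * sharp (G := G c) (sigma c) a x).
    rewrite /K /Psi /evalT /gradient /laplacian /gtrace /Hess !gE.
    rewrite (bilin_gradient (yG c) (uG c) (u' c) Ax) (bilin_gradient (yG c) (uG c) (sigma c) Ax).
    have -> : expR (2 * sigma c x) = loc phi c x ^+ 2.
      by rewrite expRM_natl lnK // posrE; exact: phi0.
    by [].
  rewrite /D KE /Ric /Hess /gL /lyra_metric gE.
  exact: (conformal_soliton (oA c) (sG c) (yG c) (uG c) (sphi c) (ss c) (phi0c c) (dphi c) _ _ Ax).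
have hE c v w x (Ax : A c x) := horizontal_defect (oA1 c.1) (oA2 c.2) (sG1 c.1) (yG1 c.1)
  (uG1 c.1) (sG2 c.2) (yG2 c.2) (uG2 c.2) (sf c) (sk c) (ss c) (su c) (f0c c) (df c)
  v w (K c x) Ax.
have vE c v w x (Ax : A c x) := vertical_defect (G1 := g1 c.1) (G2 := g2 c.2) (f := loc f c)
  (ss c) (su c) v w (K c x) Ax.
have mE c v U x (sU : smooth_on (chart_cod (charts M2 c.2)) U) (Ax : A c x) :=
  mixed_defect (oA1 c.1) (oA2 c.2) (sG1 c.1) (yG1 c.1)
  (uG1 c.1) (sG2 c.2) (yG2 c.2) (uG2 c.2) (sf c) (sk c) (ss c) (su c) (f0c c) (df c)
  v (K c x) sU Ax.
split=> [sol|[Hh Hv Hm] [i j] x Ax].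
  have D0 c x a b : A c x -> D c x a b = 0.
    by move=> Ax; exact: ((key c x Ax).1 (sol c x Ax)).
  split.
  - move=> _ _ [X sX ->] [Y sY ->] [i j] x Ax; apply: subr0_eq.
    apply: (etrans (hE (i, j) (X i (lsubmx x)) (Y i (lsubmx x)) x Ax)).
    by apply: dsum0 => b c; exact: D0.
  - move=> _ _ [U sU ->] [V sV ->] [i j] x Ax; apply: subr0_eq.
    rewrite /evalT /Ric /Hess !gE.
    apply: (etrans (vE (i, j) (U j (rsubmx x)) (V j (rsubmx x)) x Ax)).
    by apply: dsum0 => b c; exact: D0.
  - move=> _ _ [X sX ->] [U sU ->] [i j] x Ax; apply: esym.
    apply: (etrans (mE (i, j) (X i (lsubmx x)) (U j) x (sU.1 j) Ax)).
    by apply: dsum0 => b c; exact: D0.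
apply/(key (i, j) x Ax) => a b.
(* Fields whose values at the base points are coordinate vectors extract a single entry from the
   contraction. *)
have mixed0 a' b' : D (i, j) x (lshift n2 a') (rshift n1 b') = 0.
  have [X sX Xx] := exists_vector_field (delta_mx 0 a') Ax.1.
  have [U sU Ux] := exists_vector_field (delta_mx 0 b') Ax.2.
  have E := Hm (hlift X) (vlift U) (ex_intro2 _ _ X sX erefl) (ex_intro2 _ _ U sU erefl)
    (i, j) x Ax.
  have := etrans (esym (mE (i, j) (X i (lsubmx x)) (U j) x (sU.1 j) Ax)) (esym E).
  by rewrite Xx Ux dsum_delta.
case: (split_ordP a) => a' ->; case: (split_ordP b) => b' ->.
- have [X sX Xx] := exists_vector_field (delta_mx 0 a') Ax.1.
  have [Y sY Yx] := exists_vector_field (delta_mx 0 b') Ax.1.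
  have E := Hh (hlift X) (hlift Y) (ex_intro2 _ _ X sX erefl) (ex_intro2 _ _ Y sY erefl)
    (i, j) x Ax.
  move/eqP : E; rewrite -subr_eq0 => /eqP E.
  have := etrans (esym (hE (i, j) (X i (lsubmx x)) (Y i (lsubmx x)) x Ax)) E.
  by rewrite Xx Yx dsum_delta.
(* The horizontal-vertical entries vanish directly; the transposed ones follow by symmetry of the
   defect. *)
- exact: mixed0.
- apply: etrans (mixed0 b' a').
  exact: (soliton_defectC (oA _) (sG _) (yG _) (uG _) (ss _) _ _ _ (su _) Ax).
- have [U sU Ux] := exists_vector_field (delta_mx 0 a') Ax.2.
  have [V sV Vx] := exists_vector_field (delta_mx 0 b') Ax.2.
  have E := Hv (vlift U) (vlift V) (ex_intro2 _ _ U sU erefl) (ex_intro2 _ _ V sV erefl)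
    (i, j) x Ax.
  move: E; rewrite /evalT /Ric /Hess !gE => /eqP; rewrite -subr_eq0 => /eqP E.
  have := etrans (esym (vE (i, j) (U j (rsubmx x)) (V j (rsubmx x)) x Ax)) E.
  by rewrite Ux Vx dsum_delta.
Qed.
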